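(* Let $X$ be a strictly convex $\mathcal{B}$ real Banach space, $C$ a nonempty closed convex subset of $X$, $(T_i)_{i\in I}$ a finite family of nonexpansive mappings $T_i:C\to C$ with $F:=\bigcap_{i\in I}\mathrm{Fix}(T_i)\ne\emptyset$, and $f:C\to C$ an $\alpha$-contraction for some $\alpha\in(0,1)$. Let $\{\alpha_n\}$ be a sequence of real numbers such that: (i) $\alpha_n\in(0,1)$ for all $n$; (ii) $\lim_{n\to\infty}\alpha_n=0$; (iii) $\sum_{n=0}^\infty\alpha_n=\infty$; and either (iv) $\sum_{n=0}^\infty|\alpha_{n+1}-\alpha_n|<\infty$ or (iv') $\lim_{n\to\infty}\alpha_{n+1}/\alpha_n=1$. Let $\lambda_{i,n}$ ($i\in I$, $n\in\mathbb{N}$) be real numbers with $\sum_{i\in I}\lambda_{i,n}=1$ for all $n$ and $\lambda_{i,n}\in[a,b]$ for all $i,n$, where $a>0$ and $b<\infty$, and such that for all $i\in I$ either $\sum_n|\lambda_{i,n+1}-\lambda_{i,n}|<\infty$ or $|\lambda_{i,n+1}-\lambda_{i,n}|/\alpha_n\to0$. Let $x_0\in C$ and $$x_{n+1}=\alpha_nf(x_n)+(1-\alpha_n)T_nx_n,\qquad T_n:=\sum_{i\in I}\lambda_{i,n}T_i .$$ Then $\{x_n\}$ converges strongly to $\mathbf{Q}_F(f)$.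
   Context: A mapping $T:C\to C$ is nonexpansive if $\|Tx-Ty\|\le\|x-y\|$ for all $x,y\in C$; $f:C\to C$ is an $\alpha$-contraction ($\alpha\in(0,1)$) if $\|f(x)-f(y)\|\le\alpha\|x-y\|$ for all $x,y\in C$. $\mathrm{Fix}(T)=\{x\in C: Tx=x\}$. The normalized duality map is $J(x)=\{x^\star\in X^\star:\langle x,x^\star\rangle=\|x\|^2=\|x^\star\|^2\}$. A ''$\mathcal{B}$ real Banach space'' is a real Banach space $X$ such that either (a) the normalized duality mapping $J$ is (single-valued and) uniformly norm-to-weak$^\star$ continuous on bounded sets, or (b) $X$ is reflexive and admits a weakly continuous duality mapping $J_\phi$ with gauge $\phi$, i.e. $\phi:[0,\infty)\to[0,\infty)$ is continuous, strictly increasing, $\phi(0)=0$, $\phi(t)\to\infty$ as $t\to\infty$, and $J_\phi(x)=\{x^\star\in X^\star:\langle x,x^\star\rangle=\|x\|\phi(\|x\|),\ \|x^\star\|=\phi(\|x\|)\}$ is single-valued and weak-to-weak$^\star$ sequentially continuous. Definition of $\mathbf{Q}_F(f)$: let $T:C\to C$ be nonexpansive with $\mathrm{Fix}(T)=F$. For $u\in C$ and $t\in(0,1)$ let $z_t\in C$ be the unique fixed point of $x\mapsto tu+(1-t)Tx$, and let $R_T(u)=\lim_{t\to0}z_t$ (strong limit). Then $R_T$ is the unique sunny nonexpansive retraction of $C$ onto $F$ (so it depends only on $F$), and $\mathbf{Q}_F(f)$ is the unique fixed point $\tilde x=R_T(f(\tilde x))$ of the contraction $R_T\circ f$. Here this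 is applied to the mappings $T=\sum_{i\in I}\lambda_iT_i$ with $\lambda_i>0$, $\sum_{i\in I}\lambda_i=1$ (all of which have fixed point set $F$ because $X$ is strictly convex), and it is understood that for these mappings the limit exists for every $u\in C$. *)

(* Defs.v *)
From HB Require Import structures.
From mathcomp Require Import all_boot all_order all_algebra.
From mathcomp Require Import all_classical all_reals all_analysis.

Set Implicit Arguments.
Unset Strict Implicit.
Unset Printing Implicit Defensive.

Import Order.TTheory GRing.Theory Num.Theory.
Import numFieldNormedType.Exports.

Local Open Scope classical_set_scope.
Local Open Scope ring_scope.

Section Dual.
Context {R : realType} {X : normedModType R}.

Definition continuous_linear : {pred X -> R^o} :=
  fun f => `[< linear f /\ continuous f >].

Fact continuous_linear_submod : submod_closed continuous_linear.
Proof.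
split; first by apply/asboolP; split;
  [move=> a x y; rewrite /= scaler0 addr0 | exact: cst_continuous].
move=> a f g /asboolP[lf cf] /asboolP[lg cg]; apply/asboolP; split.
  move=> b x y /=.
  rewrite !fctE lf lg !scalerDr !scalerA (mulrC a b).
  by rewrite [LHS]addrACA.
by move=> x; exact: (cvgD (cvgZl_tmp (k := a) (cf x)) (cg x)).
Qed.

HB.instance Definition _ :=
  GRing.isSubmodClosed.Build R (X -> R^o) continuous_linear
    continuous_linear_submod.

End Dual.

(** The topological dual, an R-module by restriction of the pointwise
    operations on [X -> R^o], normed below by the operator norm. *)
Record dual (R : realType) (X : normedModType R) := Dual {
  dual_fun :> X -> R^o ;
  _ : dual_fun \in continuous_linear }.

HB.instance Definition _ (R : realType) (X : normedModType R) :=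
  [isSub for @dual_fun R X].
HB.instance Definition _ (R : realType) (X : normedModType R) :=
  [Choice of dual X by <:].
HB.instance Definition _ (R : realType) (X : normedModType R) :=
  [SubChoice_isSubLmodule of dual X by <:].

Section DualNorm.
Context {R : realType} {X : normedModType R}.
Implicit Types (f g : dual X) (x : X).

Definition dual_norm f : R := sup [set `|f x| | x in [set x | `|x| <= 1]].

Lemma dual_linear f : linear f.
Proof. by case: f => f /= /asboolP[]. Qed.

Lemma dual_continuous f : continuous f.
Proof. by case: f => f /= /asboolP[]. Qed.

Let lin f : {linear X -> R^o} :=
  HB.pack (f : X -> R^o) (GRing.isLinear.Build _ _ _ _ (f : X -> R^o) (dual_linear f)).

Lemma dual_fun0 f : f 0 = 0.
Proof. exact: (linear0 (lin f)). Qed.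

Lemma dual_funZ f (a : R) x : f (a *: x) = a * f x.
Proof. exact: (linearZ_LR (lin f) a x). Qed.

Lemma dual_norm_has_sup f : has_sup [set `|f x| | x in [set x | `|x| <= 1]].
Proof.
split; first by exists `|f 0|, 0 => //=; rewrite normr0.
have /linear_bounded_continuous/bounded_funP/(_ 1)[M fM] :
  continuous (lin f) by exact: dual_continuous.
by exists M => _ [x x1 <-]; exact: fM.
Qed.

Lemma le_dual_norm_unit f x : `|x| <= 1 -> `|f x| <= dual_norm f.
Proof.
by move=> x1; apply: sup_upper_bound; [exact: dual_norm_has_sup | exists x].
Qed.

Lemma dual_norm_le f (M : R) :
  (forall x, `|x| <= 1 -> `|f x| <= M) -> dual_norm f <= M.
Proof.
move=> fM; apply: ge_sup; first by case: (dual_norm_has_sup f).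
by move=> _ [x x1 <-]; exact: fM.
Qed.

Lemma dual_norm_ge0 f : 0 <= dual_norm f.
Proof.
by apply: le_trans (@le_dual_norm_unit f 0 _); rewrite ?normr0.
Qed.

Lemma le_dual_norm f x : `|f x| <= dual_norm f * `|x|.
Proof.
have [->|x0] := eqVneq x 0; first by rewrite dual_fun0 !normr0 mulr0.
have nx : 0 < `|x| by rewrite normr_gt0.
have : `|f (`|x|^-1 *: x)| <= dual_norm f.
  by apply: le_dual_norm_unit; rewrite normrZ normfV normr_id mulVf ?gt_eqF.
by rewrite dual_funZ normrM normfV normr_id mulrC ler_pdivrMr.
Qed.

Let dual_normD f g : dual_norm (f + g) <= dual_norm f + dual_norm g.
Proof.
apply: dual_norm_le => x x1.
by rewrite (le_trans (ler_normD _ _)) ?lerD ?le_dual_norm_unit.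
Qed.

Let dual_normZ_le (a : R) f : dual_norm (a *: f) <= `|a| * dual_norm f.
Proof.
apply: dual_norm_le => x x1.
by rewrite (normrM a (f x)) ler_wpM2l ?le_dual_norm_unit.
Qed.

Let dual_normZ (a : R) f : dual_norm (a *: f) = `|a| * dual_norm f.
Proof.
have [->|a0] := eqVneq a 0.
  apply/eqP; rewrite normr0 mul0r eq_le dual_norm_ge0 andbT.
  by rewrite (le_trans (dual_normZ_le _ _)) ?normr0 ?mul0r.
apply/eqP; rewrite eq_le dual_normZ_le /=.
rewrite -{1}(scalerK a0 f) -ler_pdivlMl ?normr_gt0// -normfV.
exact: dual_normZ_le.
Qed.

Let dual_norm0_eq0 f : dual_norm f = 0 -> f = 0.
Proof.
move=> f0; apply/val_inj/funext => x /=; apply/eqP.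
by rewrite -normr_le0 (le_trans (le_dual_norm f x))// f0 mul0r.
Qed.

HB.instance Definition _ :=
  @Lmodule_isNormed.Build R (dual X) dual_norm
    dual_normD dual_normZ dual_norm0_eq0.

Lemma dual_normE f :
  `|f| = sup [set `|f x| | x in [set x | `|x| <= 1]].
Proof. by []. Qed.

End DualNorm.

Section BanachSpaces.
Context {R : realType} (X : normedModType R).

Definition strictly_convex :=
  forall x y : X, `|x| = 1 -> `|y| = 1 -> x <> y -> `|2^-1 *: (x + y)| < 1.

Definition reflexive_space :=
  forall Phi : dual (dual X), exists x : X, forall g : dual X, Phi g = g x.

Definition weak_cvg (u : nat -> X) (l : X) :=
  forall g : dual X, g (u n) @[n --> \oo] --> g l.

Definition weakstar_cvg (v : nat -> dual X) (g : dual X) :=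
  forall x : X, v n x @[n --> \oo] --> g x.

Definition normalized_duality (x : X) : set (dual X) :=
  [set g : dual X | g x = `|x| ^+ 2 /\ `|g| ^+ 2 = `|x| ^+ 2].

Definition duality_map (phi : R -> R) (x : X) : set (dual X) :=
  [set g : dual X | g x = `|x| * phi `|x| /\ `|g| = phi `|x|].

(** Only the restriction of [phi] to [[0, +oo[] is constrained (and used). *)
Definition gauge (phi : R -> R) :=
  [/\ forall t, 0 <= t -> 0 <= phi t,
      {within `[0, +oo[, continuous phi},
      forall s t, 0 <= s -> s < t -> phi s < phi t,
      phi 0 = 0 &
      phi t @[t --> +oo] --> +oo].

(** The weak-star uniformity is generated by the entourages
    [|g y - g' y| < e] for [y : X] and [e > 0]. *)
Definition norm_weakstar_unif_continuous_on (B : set X) (j : X -> dual X) :=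
  forall (y : X) (e : R), 0 < e -> exists2 d : R, 0 < d &
    forall x x', B x -> B x' -> `|x - x'| < d -> `|j x y - j x' y| < e.

Definition weak_weakstar_seq_continuous (j : X -> dual X) :=
  forall (u : nat -> X) (l : X), weak_cvg u l -> weakstar_cvg (j \o u) (j l).

Definition B_space :=
  (exists2 j : X -> dual X,
     (forall x, normalized_duality x = [set j x]) &
     (forall B : set X, bounded_set B -> norm_weakstar_unif_continuous_on B j))
  \/
  (reflexive_space /\
   exists phi : R -> R, gauge phi /\
     exists2 j : X -> dual X,
       (forall x, duality_map phi x = [set j x]) &
       weak_weakstar_seq_continuous j).

End BanachSpaces.

(** A mapping [C -> C] is represented by a total function on [X] that maps [C]
    into [C]; its values outside [C] are irrelevant. *)
Section FixedPoints.
Context {R : realType} {X : completeNormedModType R}.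
Implicit Types (C F : set X) (T f : X -> X).

Definition nonexpansive C T := set_fun C C T /\ 1.-lipschitz_C T.

Definition contraction_on (alpha : R) C f :=
  [/\ 0 < alpha, alpha < 1, set_fun C C f & alpha.-lipschitz_C f].

Definition Fix C T : set X := [set x | C x /\ T x = x].

Definition approx_fix C T (u : X) (t : R) : X :=
  xget 0 [set z | C z /\ z = t *: u + (1 - t) *: T z].

Definition approx_fix_cvg C T :=
  forall u, C u -> cvg (approx_fix C T u t @[t --> 0^'+]).

Definition retr C T (u : X) : X := lim (approx_fix C T u t @[t --> 0^'+]).

(** The unique fixed point of [R_T \o f].  In a B space, for every admissible [T] (with
    [Fix C T = F]) [retr C T] is the unique sunny nonexpansive retraction of [C]
    onto [F], so the set below has at most one element. *)
Definition QF C F f : X :=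
  xget 0 [set x | C x /\ exists T,
    [/\ nonexpansive C T, Fix C T = F, approx_fix_cvg C T
      & x = retr C T (f x)]].

End FixedPoints.

(* Main.v *)
Require Import Defs.
From HB Require Import structures.
From mathcomp Require Import all_boot all_order all_algebra.
From mathcomp Require Import all_classical all_reals all_analysis.
From mathcomp Require Import ring lra.

Set Implicit Arguments.
Unset Strict Implicit.
Unset Printing Implicit Defensive.

Import Order.TTheory GRing.Theory Num.Theory.
Import numFieldNormedType.Exports.

Local Open Scope classical_set_scope.
Local Open Scope ring_scope.

(** In both cases the space carries a normalized duality map [J] that is
    uniformly norm-to-weak-star continuous on bounded sets.  In case (b) one
    rescales the weakly continuous duality map: a failure of uniform continuity
    would give two bounded sequences with differences tending to 0, which have
    subsequences converging weakly to the same point.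

    For [z_t = t u + (1 - t) S z_t] and any [x] one has
    [<u - z_t, J (x - z_t)> <= t^-1 |x - S x| |x - z_t|], so [q = lim z_t]
    satisfies [limsup <u - q, J (x_n - q)> <= 0] as soon as [x_n - S x_n] tends
    to 0, and [q] depends only on the fixed point set of [S].  The weights of
    [T_n] need not converge, but along every ultrafilter they do, and the limit
    mapping [S] has fixed point set [F] by strict convexity.  The theorem then
    follows from the recursion
    [|x_(n+1) - q|^2 <= (1 - (1 - alpha) al_n) |x_n - q|^2 + o(al_n)]. *)

(** * Ultrafilters and limits of bounded functions *)

(** If [P] were not in [F], the trace of [F] on the complement of [P] would be a proper filter, and
    an ultrafilter refining it would contain both [P] and its complement. Eventual statements may
    thus be checked along ultrafilters, where every bounded function converges. *)
Lemma filter_ultra (T : Type) (F : set_system T) (FF : Filter F) (P : set T) :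
  (forall G, UltraFilter G -> F `<=` G -> G P) -> F P.
Proof.
move=> FG; apply: contrapT => FnP.
have wP : ProperFilter (within (~` P) F).
  split; last exact: within_filter.
  by rewrite /within /= => F0; apply: FnP; apply: filterS F0 => x nP; apply: contrapT => /nP.
have [G [uG wG]] := ultraFilterLemma wP.
have FsubG : F `<=` G 
  by move=> A FA; apply: wG; exact: (filterS (fun x Ax _ => Ax) FA).
have GnP : G (~` P) by apply: wG; apply: (@filterE _ F) => x.
have [x [Px nPx]] := filter_ex (filterI (FG G uG FsubG) GnP).
exact: nPx.
Qed.

(** Compactness of [[-M, M]] gives a cluster point, and an ultrafilter converges to each of its
    cluster points. *)
Lemma ultra_bounded_cvg (R : realType) (T : Type) (G : set_system T)
    (uG : UltraFilter G) (u : T -> R) (M : R) :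
  (forall x, `|u x| <= M) -> exists l : R, u x @[x --> G] --> l.
Proof.
move=> uM.
have [|l [_ cl]] := @segment_compact R (- M) M (u @ G) _.
  by apply: (@filterE _ G) => x /=; rewrite in_itv /= -ler_norml.
exists l => B lB.
have [//|GnB] := in_ultra_setVsetC (u @^-1` B) uG.
have [|y [nBy By]] := cl (~` B) B _ lB; first exact: GnB.
by [].
Qed.

(** * Sublinear functionals and the Hahn-Banach theorem *)

Section Sublinear.
Context {R : realType} {V : lmodType R}.
Implicit Types (p q : V -> R) (x y : V).

Definition sublinear p :=
  (forall x y, p (x + y) <= p x + p y) /\
  (forall (t : R) x, 0 <= t -> p (t *: x) = t * p x).

Lemma sublinear0 p : sublinear p -> p 0 = 0.
Proof. by move=> [_ pZ]; rewrite -(scale0r 0) pZ ?mul0r. Qed.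

Lemma sublinear_lower p x : sublinear p -> - p (- x) <= p x.
Proof.
move=> sp; have := sp.1 x (- x); rewrite subrr sublinear0 //; lra.
Qed.

(** The members [a i] need not be sublinear one by one: the inequality for a sum may combine two
    indices into a third. The bound [- p (- x)] keeps the infima finite. This serves straightenings,
    infima of chains and distances to a subspace alike. *)
Lemma sublinear_inf (I : Type) (D : set I) (a : I -> V -> R) p :
  p 0 = 0 -> (forall i, D i -> forall x, - p (- x) <= a i x) ->
  (forall i j, D i -> D j -> forall x y,
     exists2 k, D k & a k (x + y) <= a i x + a j y) ->
  (forall i, D i -> forall (t : R) x, 0 < t ->
     exists2 k, D k & a k (t *: x) <= t * a i x) ->
  (exists2 i, D i & a i 0 <= 0) ->
  sublinear (fun x => inf [set a i x | i in D]).
Proof.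
move=> p0 pa aD aZ [i0 Di0 a0].
set m := fun x => inf _.
have m_le i x : D i -> m x <= a i x.
  move=> Di; apply: ge_inf; last by exists i.
  by exists (- p (- x)) => _ [j Dj <-]; exact: pa.
have le_m x c : (forall i, D i -> c <= a i x) -> c <= m x.
  move=> ca; apply: lb_le_inf; first by exists (a i0 x), i0.
  by move=> _ [j Dj <-]; exact: ca.
have mZ (t : R) x : 0 < t -> m (t *: x) <= t * m x.
  move=> t0; rewrite -ler_pdivrMl//; apply: le_m => i Di.
  have [k Dk] := aZ i Di t x t0; rewrite ler_pdivrMl//.
  exact/le_trans/m_le.
have m0 : m 0 = 0.
  apply/eqP; rewrite eq_le; apply/andP; split; first exact: le_trans (m_le i0 0 Di0) a0.
  by apply: le_m => i Di; have := pa i Di 0; rewrite oppr0 p0 oppr0.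
split=> [x y|t x].
  rewrite -lerBlDr; apply: (le_m) => i Di; rewrite lerBlDr -lerBlDl.
  apply: le_m => j Dj; rewrite lerBlDl.
  by have [k Dk] := aD i j Di Dj x y; exact/le_trans/m_le.
rewrite le_eqVlt => /predU1P[<-|t0]; first by rewrite scale0r mul0r.
(* The reverse inequality is [mZ] at [t *: x] with the factor [t^-1]. *)
apply/eqP; rewrite eq_le mZ//= -ler_pdivlMl//.
have tV : 0 < t^-1 by rewrite invr_gt0.
by rewrite -[leLHS](_ : m (t^-1 *: (t *: x)) = _) ?mZ ?scalerK ?gt_eqF.
Qed.

(* The sublinear functional obtained from [p] by forcing linearity along [y];
   a minimal sublinear functional is unchanged by it, hence linear. *)
Definition straighten p y x : R :=
  inf [set p (x + t *: y) - t * p y | t in [set t : R | 0 <= t]].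

Lemma straighten_le p y x (t : R) : sublinear p -> 0 <= t ->
  straighten p y x <= p (x + t *: y) - t * p y.
Proof.
move=> sp t0; apply: ge_inf; last by exists t.
exists (- p (- x)) => _ [s s0 <-].
have := sp.1 (x + s *: y) (- x).
by rewrite addrAC subrr add0r sp.2//; lra.
Qed.

Lemma straighten_sublinear p y : sublinear p -> sublinear (straighten p y).
Proof.
move=> sp; apply: (@sublinear_inf R [set t : R | 0 <= t]
  (fun t x => p (x + t *: y) - t * p y) p).
- exact: sublinear0.
- move=> s s0 x; have := sp.1 (x + s *: y) (- x).
  by rewrite addrAC subrr add0r sp.2//; lra.
- move=> s t /= s0 t0 x x'; exists (s + t); first exact: addr_ge0.
  have := sp.1 (x + s *: y) (x' + t *: y).
  by rewrite addrACA -scalerDl; lra.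
- move=> s /= s0 t x t0; exists (t * s); first by rewrite mulr_ge0 // ltW.
  by rewrite -scalerA -scalerDr sp.2 ?(ltW t0)// mulrBr mulrA.
- by exists 0; rewrite /= ?lexx// scale0r mul0r addr0 subr0 sublinear0.
Qed.

(** Zorn's lemma applies because the pointwise infimum of a nonempty chain of sublinear functionals
    below [p] is again one; the empty chain is bounded by [p]. *)
Lemma minimal_sublinear p : sublinear p -> exists2 g : V -> R,
  sublinear g /\ (forall x, g x <= p x) &
  forall q, sublinear q -> (forall x, q x <= g x) -> q = g.
Proof.
move=> sp.
pose S := {q : V -> R | sublinear q /\ forall x, q x <= p x}.
(* The order is reversed, so that a maximal element is a minimal functional. *)
pose Rl (r s : S) : bool := `[< forall x, sval s x <= sval r x >].
have [||||[g [sg gp]] gmin] := @Zorn S Rl.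
- by move=> t; apply/asboolP.
- by move=> r s t /asboolP rs /asboolP st; apply/asboolP => x;
    exact: le_trans (st x) (rs x).
- move=> [s Ps] [t Pt] /asboolP /= st /asboolP /= ts.
  have E : s = t by apply/funext => x; apply/eqP; rewrite eq_le st ts.
  by subst t; congr exist; exact: Prop_irrelevance.
- move=> A Atot; have [A0|/set0P[s0 As0]] := eqVneq A set0.
    by exists (exist _ p (conj sp (fun x => lexx _))) => s; rewrite A0.
  pose m x := inf [set sval s x | s in A].
  have lower (s : S) x : - p (- x) <= sval s x.
    case: s => q [sq qp] /=; apply: le_trans (sublinear_lower x sq).
    by rewrite lerN2.
  have m_le s x : A s -> m x <= sval s x.
    move=> As; apply: ge_inf; last by exists s.
    by exists (- p (- x)) => _ [t At <-]; exact: lower.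
  have sm : sublinear m.
    apply: (@sublinear_inf S A (fun s => sval s) p).
    + exact: sublinear0.
    + by move=> s As x; exact: lower.
    + move=> s t As At x y.
      have [/asboolP st|/asboolP ts] := Atot s t As At.
        exists t => //; apply: le_trans ((svalP t).1.1 x y) _.
        by rewrite lerD2r.
      exists s => //; apply: le_trans ((svalP s).1.1 x y) _.
      by rewrite lerD2l.
    + by move=> s As t x t0; exists s; rewrite // (svalP s).1.2// ltW.
    + by exists s0; rewrite ?(sublinear0 (svalP s0).1).
  have mp x : m x <= p x by apply: le_trans (m_le s0 x As0) ((svalP s0).2 x).
  exists (exist _ m (conj sm mp)) => s As; apply/asboolP => x /=.
  exact: m_le.
- exists g => // q sq qg.
  have qp x : q x <= p x by exact: le_trans (qg x) (gp x).
  by have [] := gmin (exist _ q (conj sq qp)) (asboolT qg).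
Qed.

(** The functional is a minimal one below [straighten p x0]. Straightening along [x0] beforehand
    forces [g (- x0) <= - p x0], hence equality at [x0]. *)
Theorem hahn_banach p x0 : sublinear p -> exists g : V -> R,
  [/\ forall (t : R) x y, g (t *: x + y) = t * g x + g y,
      forall x, g x <= p x & g x0 = p x0].
Proof.
move=> sp; have [g [sg gp] gmin] := minimal_sublinear (straighten_sublinear x0 sp).
have gD x y : g (x + y) = g x + g y.
  apply/eqP; rewrite eq_le sg.1 /= -lerBrDr.
  (* Minimality gives [straighten g y = g]; the parameter 1 in the infimum then yields
     [g x <= g (x + y) - g y]. *)
  rewrite -[in leLHS](gmin _ (straighten_sublinear y sg)).
    by have := @straighten_le g y x 1 sg ler01; rewrite scale1r mul1r.
  by move=> z; have := @straighten_le g y z 0 sg (lexx _);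
    rewrite scale0r mul0r addr0 subr0.
have gN x : g (- x) = - g x.
  by apply/eqP; rewrite -addr_eq0 -gD addNr sublinear0.
have gle x : g x <= p x.
  apply: le_trans (gp x) _; have := @straighten_le p x0 x 0 sp (lexx _).
  by rewrite scale0r mul0r addr0 subr0.
exists g; split => //.
- move=> t x y; rewrite gD; congr (_ + _).
  have [t0|t0] := leP 0 t; first exact: sg.2.
  by rewrite -[t *: x]opprK -scaleNr gN sg.2 ?mulNr ?opprK// oppr_ge0 ltW.
- apply/eqP; rewrite eq_le gle /= -lerN2 -gN.
  apply: le_trans (gp _) _; apply: le_trans (straighten_le _ _ sp ler01) _.
  by rewrite scale1r addNr sublinear0// mul1r sub0r.
Qed.

End Sublinear.

(** * Norming and separating functionals *)

Section DualFunctionals.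
Context {R : realType} {V : normedModType R}.
Implicit Types (g : dual V) (x y : V).

Lemma dual_funD g x y : g (x + y) = g x + g y.
Proof. by have := dual_linear g 1 x y; rewrite !scale1r. Qed.

Lemma dual_funN g x : g (- x) = - g x.
Proof. by rewrite -scaleN1r dual_funZ mulN1r. Qed.

Lemma dual_funB g x y : g (x - y) = g x - g y.
Proof. by rewrite dual_funD dual_funN. Qed.

Lemma ler_dual_norm g x : `|g x| <= `|g| * `|x|.
Proof. exact: le_dual_norm. Qed.

Lemma bounded_dual (h : V -> R) (M : R) :
  (forall (t : R) x y, h (t *: x + y) = t * h x + h y) ->
  (forall x, `|h x| <= M * `|x|) -> exists g, forall x, g x = h x.
Proof.
move=> hlin hM; pose h' : V -> R^o := h.
have hl : linear h' by move=> t x y; exact: hlin.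
pose H : {linear V -> R^o} :=
  HB.pack h' (GRing.isLinear.Build _ _ _ _ h' hl).
have hc : continuous h'.
  apply: (@bounded_linear_continuous _ _ _ H); apply/bounded_funP => r.
  exists (`|M| * `|r|) => x xr; apply: le_trans (hM x) _.
  apply: le_trans (ler_wpM2r (normr_ge0 _) (ler_norm M)) _.
  by rewrite ler_wpM2l// (le_trans xr) ?ler_norm.
have hin : h' \in continuous_linear by apply/asboolP.
by exists (Dual hin).
Qed.

Lemma sublinear_normr : sublinear (fun x : V => `|x|).
Proof.
by split=> [x y|t x t0]; [exact: ler_normD | rewrite normrZ ger0_norm].
Qed.

Lemma dominated_dual (p : V -> R) x0 : sublinear p ->
  (forall x, p x <= `|x|) ->
  exists g, [/\ forall x, g x <= p x, forall x, `|g x| <= `|x| & g x0 = p x0].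
Proof.
move=> sp pn; have [h [hl hp hx0]] := hahn_banach x0 sp.
have hN x : h (- x) = - h x.
  have h0 : h 0 = 0 by have := hl 1 0 0; rewrite scale1r mul1r addr0; lra.
  by rewrite -scaleN1r -[_ *: x]addr0 hl h0 mulN1r addr0.
have hn x : `|h x| <= `|x|.
  rewrite ler_norml (le_trans (hp _) (pn _)) andbT lerNl -hN.
  by rewrite -(normrN x) (le_trans (hp _) (pn _)).
have [g gE] : exists g, forall x, g x = h x.
  by apply: (@bounded_dual _ 1) => // x; rewrite mul1r.
by exists g; split=> [x|x|]; rewrite gE.
Qed.

Lemma norming_functional x0 :
  exists g, (forall x, `|g x| <= `|x|) /\ g x0 = `|x0|.
Proof.
by have [//|g [_ gn gx]] := dominated_dual x0 sublinear_normr; exists g.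
Qed.

(** The distance to the subspace [D] is sublinear, at most the norm, at most 0 on [D] and at least
    [e] at [x0]; a linear functional below it that agrees with it at [x0] separates. *)
Lemma separating_functional (D : set V) x0 (e : R) :
  D 0 -> (forall (t : R) x y, D x -> D y -> D (t *: x + y)) ->
  0 < e -> (forall y, D y -> e <= `|x0 - y|) ->
  exists g, (forall y, D y -> g y = 0) /\ 0 < g x0.
Proof.
move=> D0 Dl e0 De; pose d x := inf [set `|x - y| | y in D].
have d_le x y : D y -> d x <= `|x - y|.
  by move=> Dy; apply: ge_inf; [exists 0 => _ [z _ <-] | exists y].
have DZ (t : R) y : D y -> D (t *: y) by move=> Dy; rewrite -[_ *: _]addr0; exact: Dl.
have sd : sublinear d.
  apply: (@sublinear_inf R V V D (fun y x => `|x - y|) (fun x => `|x|)).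
  - by rewrite normr0.
  - by move=> y _ x; rewrite (le_trans _ (normr_ge0 _))// oppr_le0.
  - move=> y z Dy Dz x x'; exists (y + z).
      by rewrite -[y]scale1r; exact: Dl.
    by rewrite opprD addrACA ler_normD.
  - move=> y Dy t x t0; exists (t *: y); first exact: DZ.
    by rewrite -scalerBr normrZ gtr0_norm.
  - by exists 0; rewrite // subr0 normr0.
have dn x : d x <= `|x| by rewrite -[x in leRHS]subr0 d_le.
have [g [gd _ gx0]] := dominated_dual x0 sd dn.
have gle y : D y -> g y <= 0.
  by move=> Dy; rewrite (le_trans (gd y))// -(normr0 V) -(subrr y) d_le.
exists g; split=> [y Dy|].
  apply/eqP; rewrite eq_le gle//= -oppr_le0 -dual_funN gle// -scaleN1r.
  exact: DZ.
rewrite gx0 (lt_le_trans e0)//; apply: lb_le_inf; first by exists `|x0 - 0|, 0.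
by move=> _ [y Dy <-]; exact: De.
Qed.

End DualFunctionals.

(** * Weak sequential compactness of bounded sets in reflexive spaces *)

Section WeakCompactness.
Context {R : realType} {V : normedModType R}.

(** The limits of [g (u t)] along [G] depend linearly and boundedly on [g], so they form an element
    of the bidual, which reflexivity represents by a point. *)
Lemma reflexive_ultra_weak_cvg (T : Type) (G : set_system T)
    (uG : UltraFilter G) (u : T -> V) (M : R) :
  reflexive_space V -> (forall t, `|u t| <= M) ->
  exists x, forall g : dual V, g (u t) @[t --> G] --> g x.
Proof.
move=> Vrefl uM.
have Lex (g : dual V) : exists l : R, g (u t) @[t --> G] --> l.
  apply: (@ultra_bounded_cvg _ _ _ _ _ (`|g| * M)) => t.
  by apply: le_trans (ler_dual_norm g (u t)) _; rewrite ler_wpM2l.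
have [L LP] := choice Lex.
have Llin (s : R) (g h : dual V) : L (s *: g + h) = s * L g + L h.
  have Lgh : (s * (g (u t) : R) + h (u t) : R) @[t --> G] --> s * L g + L h.
    by apply: cvgD (LP h); apply: cvgMl_tmp; exact: LP.
  exact: (cvg_unique (@norm_hausdorff _ _) (LP (s *: g + h)) Lgh).
have LM (g : dual V) : `|L g| <= M * `|g|.
  apply: (closed_cvg (fun y : R => y <= M * `|g|) (@closed_le _ _)) (cvg_norm (LP g)).
  apply: filterE => t /=; apply: le_trans (ler_dual_norm g (u t)) _.
  by rewrite mulrC ler_wpM2r.
have [Phi PhiE] := @bounded_dual R (dual V) L M Llin LM.
have [x xE] := Vrefl Phi.
by exists x => g; rewrite -xE PhiE.
Qed.

(* [p] is a limit of the [u n] for the weak topology along an ultrafilter, so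
   by Hahn-Banach it cannot be separated from a subspace containing them. *)
Lemma weak_cvg_adherent (T : Type) (G : set_system T) (GG : ProperFilter G)
    (u : T -> V) (p : V) (E : set V) :
  E 0 -> (forall (t : R) x y, E x -> E y -> E (t *: x + y)) ->
  (forall t, E (u t)) -> (forall g : dual V, g (u t) @[t --> G] --> g p) ->
  forall e : R, 0 < e -> exists2 y, E y & `|p - y| < e.
Proof.
move=> E0 Elin Eu up e e0; apply: contrapT => noE.
have Ee y : E y -> e <= `|p - y|.
  by move=> Ey; rewrite leNgt; apply/negP => pye; apply: noE; exists y.
have [g [gE gp]] := separating_functional E0 Elin e0 Ee.
have g0 : g (u t) @[t --> G] --> (0 : R).
  by under eq_fun do rewrite gE//; exact: cvg_cst.
by move: gp; rewrite (cvg_unique (@norm_hausdorff _ _) (up g) g0) ltxx.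
Qed.

Section RationalSpan.
Variable u : nat -> V.

(** Polynomials over [rat] encode finitely supported coefficient sequences: they form a countable
    type, so all combinations can be enumerated, and they carry the vector space operations. *)
Definition rat_comb (c : {poly rat}) : V := \sum_(i < size c) ratr c`_i *: u i.

Lemma rat_combE (c : {poly rat}) n : (size c <= n)%N ->
  rat_comb c = \sum_(i < n) ratr c`_i *: u i.
Proof.
move=> cn; rewrite /rat_comb (big_ord_widen n (fun i => ratr c`_i *: u i) cn).
rewrite big_mkcond /=; apply: eq_bigr => i _; case: ltnP => // ci.
by rewrite nth_default// rmorph0 scale0r.
Qed.

Lemma rat_comb_lin (q : rat) (c d : {poly rat}) :
  rat_comb (q *: c + d) = ratr q *: rat_comb c + rat_comb d.
Proof.
pose n := maxn (size (q *: c + d)) (maxn (size c) (size d)).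
rewrite !(@rat_combE _ n) ?leq_max ?leqnn ?orbT//.
rewrite scaler_sumr -big_split /=; apply: eq_bigr => i _.
by rewrite coefD coefZ rmorphD rmorphM scalerDl scalerA.
Qed.

Definition rat_adherent : set V :=
  [set v | forall e : R, 0 < e -> exists c, `|v - rat_comb c| < e].

Lemma rat_adherent_comb c : rat_adherent (rat_comb c).
Proof. by move=> e e0; exists c; rewrite subrr normr0. Qed.

Lemma rat_comb0 : rat_comb 0 = 0.
Proof. by rewrite /rat_comb size_poly0 big_ord0. Qed.

Lemma rat_combX n : rat_comb 'X^n = u n.
Proof.
rewrite (@rat_combE _ n.+1) ?size_polyXn//.
rewrite big_ord_recr /= big1 ?add0r => [|i _]; rewrite coefXn.
  by rewrite eqxx rmorph1 scale1r.
by rewrite ltn_eqF// rmorph0 scale0r.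
Qed.

(** Replacing the real factor [t] by a close rational [q] costs [(q - t)] times a fixed combination,
    so the closure of the rational span is a real subspace. *)
Lemma rat_adherent_lin (t : R) x y :
  rat_adherent x -> rat_adherent y -> rat_adherent (t *: x + y).
Proof.
move=> Ax Ay e e0.
have t0 : 0 < `|t| + 1 by rewrite ltr_wpDl.
have e3 : 0 < e / 3 by lra.
have [c xc] := Ax (e / 3 / (`|t| + 1)) (divr_gt0 e3 t0).
have [d yd] := Ay (e / 3) e3.
have c0 : 0 < `|rat_comb c| + 1 by rewrite ltr_wpDl.
have tlt : t < t + e / 3 / (`|rat_comb c| + 1) by rewrite ltrDl divr_gt0.
have [q] := rat_in_itvoo tlt.
rewrite in_itv /= => /andP[tq qt].
exists (q *: c + d); rewrite rat_comb_lin.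
have -> : t *: x + y - (ratr q *: rat_comb c + rat_comb d) =
    t *: (x - rat_comb c) + (y - rat_comb d) - (ratr q - t) *: rat_comb c.
  rewrite scalerBr scalerBl opprB [RHS]addrAC [X in _ = X + _]addrA subrK [RHS]addrACA.
  by rewrite opprD.
have h1 : `|t *: (x - rat_comb c)| <= e / 3.
  rewrite normrZ; move: xc; rewrite ltr_pdivlMr// => xc.
  by apply: le_trans (ltW xc); rewrite mulrC ler_wpM2l// lerDl.
have h2 : `|(ratr q - t) *: rat_comb c| < e / 3.
  rewrite normrZ gtr0_norm ?subr_gt0//.
  have qc : (ratr q - t) * (`|rat_comb c| + 1) < e / 3.
    by rewrite -ltr_pdivlMr// ltrBlDl.
  by apply: le_lt_trans qc; rewrite ler_wpM2l ?lerDl// subr_ge0 ltW.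
have := ler_normB (t *: (x - rat_comb c) + (y - rat_comb d)) ((ratr q - t) *: rat_comb c).
have := ler_normD (t *: (x - rat_comb c)) (y - rat_comb d).
lra.
Qed.

End RationalSpan.

(* The subsequence converges along countably many functionals norming the
   rational span of [u]; all its weak ultralimits lie in the closure of this
   span, where these functionals separate points. *)
Theorem reflexive_weak_cvg_subseq (u : nat -> V) (M : R) :
  reflexive_space V -> (forall n, `|u n| <= M) ->
  exists2 k : nat -> nat, (forall n, n <= k n)%N & exists p, weak_cvg (u \o k) p.
Proof.
move=> Vrefl uM.
have [G [uG Goo]] := ultraFilterLemma (eventually_filter).
have [p up] := reflexive_ultra_weak_cvg uG Vrefl uM.
(* [c] enumerates all coefficient polynomials, with 0 for the codes that decode to nothing, and
   [g i] norms the combination of [c i]. *)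
pose c i : {poly rat} := odflt 0 (unpickle i).
have [g gP] := choice (fun i => norming_functional (rat_comb u (c i))).
(* At the index chosen for [n] the first [n] norming functionals are within [1 / (n + 1)] of their
   values at [p]. *)
have kex n : exists m, (n <= m)%N /\
    forall i : 'I_n, `|g i p - g i (u m)| < n.+1%:R^-1.
  apply: (@filter_ex _ G); apply: filterI; first exact/Goo/nbhs_infty_ge.
  apply: filter_forall => i.
  by move/cvgrPdist_lt: (up (g i)); apply; rewrite invr_gt0.
have [k kP] := choice kex.
exists k => [n|]; first by have [] := kP n.
exists p => h.
have gk i : g i (u (k n)) @[n --> \oo] --> g i p.
  apply/cvgrPdist_lt => e e0; near=> n.
  have in_ : (i < n)%N by near: n; exact: nbhs_infty_gt.
  apply: lt_trans ((kP n).2 (Ordinal in_)) _.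
  by near: n; exact: near_infty_natSinv_lt (PosNum e0).
(* Along any ultrafilter [H] the subsequence has a weak limit [p']; it remains to see that
   [p' = p]. *)
apply/cvgrPdist_lt => e e0; apply: filter_ultra => H uH ooH.
have [p' up'] := reflexive_ultra_weak_cvg uH Vrefl (fun n => uM (k n)).
have gp i : g i p = g i p'.
  apply: (cvg_unique (@norm_hausdorff _ _) _ (up' (g i))).
  by move=> B /(gk i); exact: ooH.
have Ap q (F : set_system nat) (FF : ProperFilter F) (v : nat -> nat) :
    (forall g : dual V, g (u (v t)) @[t --> F] --> g q) -> rat_adherent u q.
  move=> uq d d0.
  have [||||y Ay qy] := @weak_cvg_adherent nat F FF (u \o v) q (rat_adherent u) _ _ _ uq (d / 2).
  - by rewrite -(rat_comb0 u); exact: rat_adherent_comb.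
  - exact: rat_adherent_lin.
  - by move=> t; rewrite /= -rat_combX; exact: rat_adherent_comb.
  - by lra.
  have [|c' yc] := Ay (d / 2); first lra.
  exists c'; have := ler_distD y q (rat_comb u c'); lra.
have wA : rat_adherent u (p - p').
  rewrite addrC -scaleN1r; apply: rat_adherent_lin.
    exact: (Ap _ H _ k).
  exact: (Ap _ G _ id).
suff -> : p = p' by move/cvgrPdist_lt: (up' h); apply.
(* Take a combination [w] within [d / 2] of [p - p']. Its norming functional vanishes at [p - p'],
   so the norm of [w] is its value at [w - (p - p')], which is below [d / 2]. *)
apply/eqP; rewrite -subr_eq0 -normr_le0; apply/ler_addgt0Pl => d d0.
rewrite addr0; have [|c' wc] := wA (d / 2); first lra.
have := (gP (pickle c')).1 (rat_comb u c' - (p - p')).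
have := (gP (pickle c')).2; rewrite /c pickleK /= => gc.
rewrite dual_funB gc dual_funB gp subrr subr0 ger0_norm// distrC.
have := ler_distD (rat_comb u c') (p - p') 0.
rewrite !subr0; lra.
Unshelve. all: by end_near. Qed.

End WeakCompactness.

(** * A uniformly norm-to-weak-star continuous normalized duality map *)

Section NormalizedDuality.
Context {R : realType} {X : normedModType R}.

Definition norm_weakstar_duality (J : X -> dual X) :=
  [/\ forall x, J x x = `|x| ^+ 2, forall x, `|J x| = `|x| &
      forall B : set X, bounded_set B -> norm_weakstar_unif_continuous_on B J].

Lemma gauge_continuous (phi : R -> R) r : gauge phi -> 0 < r ->
  {for r, continuous phi}.
Proof.
move=> [_ cphi _ _ _] r0.
apply: (@within_continuous_continuous _ _ _ (r / 2) (r + 1)).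
- lra.
- apply: continuous_subspaceW cphi => s /=; rewrite !in_itv /=.
  by move=> /andP[sr _]; rewrite andbT; lra.
- by rewrite in_itv /=; apply/andP; split; lra.
Qed.

Lemma gauge_gt0 (phi : R -> R) r : gauge phi -> 0 < r -> 0 < phi r.
Proof. by move=> [_ _ incr phi0 _] r0; rewrite -phi0; apply: incr. Qed.

(** Weak convergence does not control the norms in the scaling factor. Along an ultrafilter,
    however, the norms of both sequences have a common limit [r], so both values of [J] at [y] tend
    to [r / phi r * j p y], against the gap [e]. *)
Lemma weakly_continuous_duality (phi : R -> R) (j : X -> dual X) :
  reflexive_space X -> gauge phi -> (forall x, duality_map phi x (j x)) ->
  weak_weakstar_seq_continuous j ->
  norm_weakstar_duality (fun x => (`|x| / phi `|x|) *: j x).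
Proof.
move=> Xrefl gphi jphi jw; set J := fun x => _.
have JE x y : J x y = `|x| / phi `|x| * j x y by [].
have phi_neq0 (x : X) : x != 0 -> phi `|x| != 0.
  by move=> x0; rewrite gt_eqF// gauge_gt0// normr_gt0.
have Jnorm x : `|J x| = `|x|.
  rewrite /J normrZ; have [->|x0] := eqVneq x 0.
    by rewrite normr0 mul0r normr0 mul0r.
  have [_ ->] := jphi x; rewrite ger0_norm ?divfK ?phi_neq0//.
  by rewrite divr_ge0// ltW// gauge_gt0// normr_gt0.
split=> // [x|B [M0 [_ BM]] y e e0].
  rewrite JE; have [-> _] := jphi x; have [->|x0] := eqVneq x 0.
    by rewrite normr0 !mul0r expr0n.
  by rewrite mulrCA divfK ?phi_neq0.
have {BM} BM x : B x -> `|x| <= M0 + 1 by apply: BM; rewrite ltrDl.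
apply: contrapT => nunif.
have ex n : exists w : X * X, [/\ B w.1, B w.2, `|w.1 - w.2| < n.+1%:R^-1 &
    e <= `|J w.1 y - J w.2 y|].
  apply: contrapT => nw; apply: nunif; exists n.+1%:R^-1; first by rewrite invr_gt0.
  move=> x x' Bx Bx' xx'; rewrite ltNge; apply/negP => exx'.
  by apply: nw; exists (x, x').
have [w wP] := choice ex.
have [|k kn [p wp]] := @reflexive_weak_cvg_subseq R X (fun n => (w n).1) (M0 + 1) Xrefl.
  by move=> n; apply: BM; have [] := wP n.
have k_small (d : R) : 0 < d -> \forall n \near \oo, `|(w (k n)).1 - (w (k n)).2| < d.
  move=> d0; near=> n; have [_ _ + _] := wP (k n) => /lt_trans; apply.
  apply: (@le_lt_trans _ _ n.+1%:R^-1).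
    by rewrite lef_pV2 ?posrE// ler_nat ltnS.
  by near: n; exact: near_infty_natSinv_lt (PosNum d0).
have w'p : weak_cvg (fun n => (w (k n)).2) p.
  move=> g.
  have gd : g ((w (k n)).1 - (w (k n)).2) @[n --> \oo] --> (0 : R).
    apply/cvgr0Pnorm_lt => d d0.
    have g0 : 0 < `|g| + 1 by rewrite ltr_wpDl.
    near=> n; apply: le_lt_trans (ler_dual_norm _ _) _.
    have nd : `|(w (k n)).1 - (w (k n)).2| < d / (`|g| + 1).
      by near: n; apply: k_small; rewrite divr_gt0.
    move: nd; rewrite ltr_pdivlMr// => nd; apply: le_lt_trans nd.
    by rewrite mulrC ler_wpM2l ?lerDl.
  have -> : (fun n => g ((w (k n)).2)) =
      (fun n => (g ((w (k n)).1) : R) - (g ((w (k n)).1 - (w (k n)).2) : R)).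
    by apply/funext => n; rewrite dual_funB opprB addrC subrK.
  by rewrite -[g p]subr0; apply: cvgB gd; exact: wp.
have [G [uG Goo]] := ultraFilterLemma (eventually_filter).
have [|r rP] := @ultra_bounded_cvg R nat G uG (fun n => `|(w (k n)).1|) (M0 + 1).
  by move=> n; rewrite normr_id; apply: BM; have [] := wP (k n).
have rP' : `|(w (k n)).2| @[n --> G] --> r.
  apply/cvgrPdist_lt => d d0.
  have d2 : 0 < d / 2 by lra.
  move/cvgrPdist_lt: rP => /(_ _ d2) rG.
  near=> n.
  have h1 : `|(w (k n)).1 - (w (k n)).2| < d / 2 by near: n; apply: Goo; exact: k_small.
  have h2 : `|r - `|(w (k n)).1| | < d / 2 by near: n.
  have h3 := ler_dist_dist (w (k n)).1 (w (k n)).2.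
  have := ler_distD `|(w (k n)).1| r `|(w (k n)).2|; lra.
have limJ (v : nat -> X) : weak_cvg v p -> `|v n| @[n --> G] --> r ->
    J (v n) y @[n --> G] --> r / phi r * j p y.
  move=> vp vr.
  have r0 : 0 <= r.
    by apply: (closed_cvg (fun s : R => 0 <= s) (@closed_ge _ _)) vr; apply: filterE.
  have jv : (j (v n) y : R) @[n --> G] --> (j p y : R).
    by move=> A /(jw v p vp y); exact: Goo.
  (* For [r = 0] the claimed limit is 0, the numerator being 0, and the norm of [J (v n)], equal to
     that of [v n], tends to 0. For [r > 0] the gauge is continuous and nonzero at [r]. *)
  move: r0; rewrite le_eqVlt => /predU1P[r0|r0].
    rewrite -r0 mul0r mul0r; apply/cvgr0Pnorm_lt => d d0.
    have y0 : 0 < `|y| + 1 by rewrite ltr_wpDl.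
    have dy : 0 < d / (`|y| + 1) by rewrite divr_gt0.
    move: vr; rewrite -r0 => /cvgr0Pnorm_lt /(_ _ dy) vG.
    near=> n; apply: le_lt_trans (ler_dual_norm _ _) _; rewrite Jnorm.
    have : `| `|v n| | < d / (`|y| + 1) by near: n.
    rewrite normr_id ltr_pdivlMr//; apply: le_lt_trans.
    by rewrite ler_wpM2l ?lerDl.
  apply: cvgM jv; apply: (cvgM vr).
  apply: cvgV; first by rewrite gt_eqF// gauge_gt0.
  exact: (cvg_comp _ _ vr (gauge_continuous gphi r0)).
have Jw0 : (J (w (k n)).1 y - J (w (k n)).2 y : R) @[n --> G] --> (0 : R).
  rewrite -(subrr (r / phi r * j p y)).
  exact: cvgB (limJ _ wp rP) (limJ _ w'p rP').
move/cvgr0Pnorm_lt : Jw0 => /(_ e e0) Gn.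
have [n /=] := @filter_ex _ G _ _ Gn.
by rewrite ltNge; have [_ _ _ ->] := wP (k n).
Unshelve. all: by end_near. Qed.

Lemma B_space_duality : B_space X -> exists J : X -> dual X, norm_weakstar_duality J.
Proof.
move=> [[j jP junif]|[Xrefl [phi [gphi [j jP jw]]]]].
  have jx x : normalized_duality x (j x) by rewrite jP.
  exists j; split=> // x; first by have [] := jx x.
  have [_ /eqP] := jx x; rewrite eqrXn2 ?normr_ge0// => /eqP //.
exists (fun x => (`|x| / phi `|x|) *: j x).
by apply: weakly_continuous_duality => // x; rewrite jP.
Qed.

End NormalizedDuality.

(** * Convex combinations of nonexpansive mappings *)

Lemma nonexpansiveP (R : realType) (X : completeNormedModType R) (C : set X)
    (S : X -> X) : nonexpansive C S ->
  forall x y, C x -> C y -> `|S x - S y| <= `|x - y|.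
Proof.
by move=> [_ lip] x y Cx Cy; have := lip (x, y) (conj Cx Cy); rewrite /= mul1r.
Qed.

Section ConvexCombinations.
Context {R : realType} {X : completeNormedModType R}.
Variables (C : set X) (I : finType).
Hypothesis C_convex : convex_set (C : set (convex_lmodType X)).

Lemma convex_comb2 (t : R) (x y : X) : 0 <= t -> t <= 1 -> C x -> C y ->
  C (t *: x + (1 - t) *: y).
Proof.
move=> t0 t1 Cx Cy.
have := C_convex (Itv01 t0 t1) (mem_set Cx) (mem_set Cy).
by rewrite inE.
Qed.

(** The weights of a tail do not sum to 1, so the induction runs on combinations divided by their
    total weight; the list [i :: s] keeps this total positive. *)
Lemma convex_comb_seq (w : I -> R) (v : I -> X) (i : I) (s : seq I) :
  (forall i, 0 < w i) -> (forall i, C (v i)) ->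
  C ((\sum_(k <- i :: s) w k)^-1 *: \sum_(k <- i :: s) w k *: v k).
Proof.
move=> w0 Cv; elim: s i => [|k s IHs] i.
  by rewrite !big_seq1 scalerK ?gt_eqF.
rewrite big_cons [X in _ *: X]big_cons.
have W0 : 0 < \sum_(l <- k :: s) w l.
  by rewrite big_cons ltr_pwDl// sumr_ge0// => l _; exact: ltW.
move: (IHs k); move: (\sum_(l <- k :: s) w l) W0 => W W0.
move: (\sum_(l <- k :: s) _) => Y CY.
have S0 : 0 < w i + W by rewrite addr_gt0.
have -> : (w i + W)^-1 *: (w i *: v i + Y) =
    (w i / (w i + W)) *: v i + (1 - w i / (w i + W)) *: (W^-1 *: Y).
  rewrite scalerDr !scalerA mulrC; congr (_ + _ *: _).
  by field; rewrite !gt_eqF.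
by apply: convex_comb2 => //; rewrite ?divr_ge0 ?ler_pdivrMr ?mul1r ?lerDl ?ltW.
Qed.

Lemma convex_comb (w : I -> R) (v : I -> X) :
  (forall i, 0 < w i) -> \sum_i w i = 1 -> (forall i, C (v i)) ->
  C (\sum_i w i *: v i).
Proof.
move=> w0 w1 Cv.
have : index_enum I != [::].
  by apply: contra_eq_neq w1 => ->; rewrite big_nil eq_sym oner_neq0.
case E : (index_enum I) => [//|i s] _.
have := convex_comb_seq i s w0 Cv; rewrite -E.
by rewrite w1 invr1 scale1r.
Qed.

Variable T : I -> X -> X.
Hypothesis T_nonexpansive : forall i, nonexpansive C (T i).

Lemma nonexpansive_comb (w : I -> R) : (forall i, 0 < w i) -> \sum_i w i = 1 ->
  nonexpansive C (fun x => \sum_i w i *: T i x).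
Proof.
move=> w0 w1; split=> [x Cx|[x y] [/= Cx Cy]].
  by apply: convex_comb => // i; exact: (T_nonexpansive i).1.
rewrite /= -sumrB (le_trans (ler_norm_sum _ _ _))// -w1 mulr_suml.
apply: ler_sum => i _; rewrite -scalerBr normrZ gtr0_norm// ler_wpM2l ?(ltW (w0 i))//.
exact: (nonexpansiveP (T_nonexpansive i)).
Qed.

(* In a strictly convex space a convex combination of vectors of norm at most
   [r] has norm [r] only if these vectors coincide. *)
Lemma Fix_comb (w : I -> R) : strictly_convex X ->
  (forall i, 0 < w i) -> \sum_i w i = 1 -> \bigcap_i Fix C (T i) !=set0 ->
  Fix C (fun x => \sum_i w i *: T i x) = \bigcap_i Fix C (T i).
Proof.
move=> sc w0 w1 [p Fp]; apply/seteqP; split=> x /=; last first.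
  move=> Fx; have [i _] : exists i : I, i \in index_enum I.
    case E : (index_enum I) => [|i s]; last by exists i; rewrite mem_head.
    by move: w1; rewrite E big_nil => /eqP; rewrite eq_sym oner_eq0.
  split; first by have [] := Fx i Logic.I.
  rewrite -[RHS]scale1r -w1 scaler_suml; apply: eq_bigr => k _.
  by have [_ ->] := Fx k Logic.I.
move=> [Cx Sx] i _; split=> //; apply: contrapT => Tix.
pose v k := T k x - p; set r := `|x - p|.
have vE : \sum_k w k *: v k = x - p.
  rewrite -[X in _ = X - _]Sx -[X in _ = _ - X]scale1r -w1 scaler_suml -sumrB.
  by apply: eq_bigr => k _; rewrite scalerBr.
have vr k : `|v k| <= r.
  have [Cp Tp] := Fp k Logic.I.
  by rewrite /v -[X in _ - X]Tp; exact: (nonexpansiveP (T_nonexpansive k)).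
have xp : x - p != v i.
  by apply: contra_notN Tix => /eqP; rewrite /v => /addIr.
have r0 : 0 < r.
  rewrite normr_gt0; apply: contraNneq xp => xp.
  by have := vr i; rewrite /r xp normr0 normr_le0 => /eqP vi0; rewrite vi0.
(* Strict convexity concerns midpoints: adding [w i *: (x - p)] to the mean [x - p] pairs [v i] with
   [x - p], while the remaining terms have norm at most [(1 - w i) * r]. *)
have r_le : 2 * r <= `|x - p + v i|.
  have tri : (1 + w i) * r <= w i * `|x - p + v i| + (1 - w i) * r.
    have -> : (1 + w i) * r = `|x - p + w i *: (x - p)|.
      rewrite -{1}[x - p]scale1r -scalerDl normrZ gtr0_norm//.
      by rewrite addr_gt0.
    rewrite -{1}vE (bigD1 i)//= addrAC -scalerDr.
    rewrite (le_trans (ler_normD _ _))// lerD//.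
      by rewrite normrZ gtr0_norm// [v i + _]addrC.
    rewrite -w1 [X in X - _](bigD1 i)//= addrAC subrr add0r mulr_suml.
    rewrite (le_trans (ler_norm_sum _ _ _))//; apply: ler_sum => k _.
    by rewrite normrZ gtr0_norm// ler_wpM2l ?(ltW (w0 k)).
  by rewrite -(ler_pM2l (w0 i)); lra.
have vir : `|v i| = r.
  have := ler_normD (x - p) (v i); rewrite -/r.
  by have := vr i => vri tri; apply/eqP; rewrite eq_le vri/=; lra.
have := sc (r^-1 *: (x - p)) (r^-1 *: v i).
rewrite !normrZ vir -/r gtr0_norm ?invr_gt0// mulVf ?gt_eqF// => /(_ erefl erefl).
rewrite -scalerDr !normrZ !gtr0_norm ?invr_gt0//.
rewrite ltr_pdivrMl// mulr1 ltr_pdivrMl// mulrC ltNge r_le => H; apply: notF.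
apply: H => /(congr1 (fun y => r *: y)); rewrite !scalerA divff ?gt_eqF// !scale1r.
exact/eqP.
Qed.
End ConvexCombinations.

(** * The approximating curve, its limit and the variational inequality *)

Section FixedPointLemmas.
Context {R : realType} {X : completeNormedModType R}.
Variable C : set X.
Hypotheses (C_closed : closed C)
  (C_convex : convex_set (C : set (convex_lmodType X))).
Implicit Types (S : X -> X) (u z : X) (J : X -> dual X).

Lemma contraction_fixpoint (g : X -> X) (q : R) : C !=set0 -> 0 <= q -> q < 1 ->
  set_fun C C g -> (forall x y, C x -> C y -> `|g x - g y| <= q * `|x - y|) ->
  exists2 x, C x & x = g x.
Proof.
move=> C0 q0 q1 Cg glip.
pose g' := mkfun_fun Cg.
have ctr : is_contraction g'.
  by exists (NngNum q0); split => // -[x y] [/= Cx Cy]; exact: glip.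
exact: banach_fixed_point ctr C_closed C0.
Qed.

Lemma approx_fixP S u (t : R) : nonexpansive C S -> C u -> 0 < t -> t < 1 ->
  let z := approx_fix C S u t in C z /\ z = t *: u + (1 - t) *: S z.
Proof.
move=> nS Cu t0 t1.
have [|||||x Cx xE] := @contraction_fixpoint (fun z => t *: u + (1 - t) *: S z) (1 - t).
- by exists u.
- lra.
- lra.
- by move=> z Cz; apply: convex_comb2 => //; rewrite ?ltW//; exact: nS.1.
- move=> x y Cx Cy; rewrite opprD addrACA subrr add0r -scalerBr normrZ.
  rewrite ger0_norm; last lra.
  by apply: ler_wpM2l; [lra | exact: (nonexpansiveP nS)].
exact: (xgetPex 0 (ex_intro (fun z => C z /\ z = t *: u + (1 - t) *: S z) x (conj Cx xE))).
Qed.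

(** One has [t *: (u - z) = (1 - t) *: (z - S z)], and [z - S z] is [x - S x] minus
    [(x - z) - (S x - S z)]. On the latter [g] is nonnegative because [S] is nonexpansive. *)
Lemma approx_fix_VI S u x (t : R) (g : dual X) : nonexpansive C S -> C u -> C x ->
  0 < t -> t < 1 -> let z := approx_fix C S u t in
  g (x - z) = `|x - z| ^+ 2 -> `|g| = `|x - z| ->
  g (u - z) <= t^-1 * (`|x - S x| * `|x - z|).
Proof.
move=> nS Cu Cx t0 t1; have [] := approx_fixP nS Cu t0 t1.
move: (approx_fix _ _ _ _) => z Cz zE /= gxz gn.
have uz : t *: (u - z) = (1 - t) *: ((x - S x) - ((x - z) - (S x - S z))).
  have tu : t *: u = z - (1 - t) *: S z by rewrite {1}zE addrK.
  have -> : x - S x - (x - z - (S x - S z)) = z - S z.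
    by rewrite (opprB (x - z)) addrA subrKA (opprB x z) [LHS]addrC subrKA.
  by rewrite !scalerBr tu (scalerBl 1 t z) scale1r addrAC.
rewrite -ler_pdivrMl ?invr_gt0// invrK -dual_funZ uz dual_funZ.
rewrite (dual_funB g (x - S x)) (dual_funB g (x - z)) gxz.
have h1 : g (x - S x) <= `|x - S x| * `|x - z|.
  by rewrite (le_trans (ler_norm _))// (le_trans (ler_dual_norm _ _))// gn mulrC.
have h2 : g (S x - S z) <= `|x - z| ^+ 2.
  rewrite (le_trans (ler_norm _))// (le_trans (ler_dual_norm _ _))// gn expr2.
  by rewrite ler_wpM2l//; exact: (nonexpansiveP nS).
have : 0 <= `|x - S x| * `|x - z| by rewrite mulr_ge0.
move: (`|x - S x| * _) h1 => K h1 K0.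
move: (`|x - z| ^+ 2) h2 => r2 h2; move: (g _) (g _) h1 h2 => A B h1 h2.
by nra.
Qed.

Lemma cvg_retr S u : approx_fix_cvg C S -> C u ->
  approx_fix C S u t @[t --> 0^'+] --> retr C S u.
Proof. by move=> cS Cu; exact: cS. Qed.

Lemma retr_in S u : nonexpansive C S -> approx_fix_cvg C S -> C u ->
  C (retr C S u).
Proof.
move=> nS cS Cu; apply: (closed_cvg C C_closed _ _ (cvg_retr cS Cu)).
near=> t; by apply: (approx_fixP nS Cu _ _).1; near: t; [exact: nbhs_right_gt|exact: nbhs_right_lt].
Unshelve. all: by end_near. Qed.

Lemma retr_nonexpansive S u v : nonexpansive C S -> approx_fix_cvg C S ->
  C u -> C v -> `|retr C S u - retr C S v| <= `|u - v|.
Proof.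
move=> nS cS Cu Cv.
apply: (closed_cvg (fun s : R => s <= `|u - v|) (@closed_le _ _) _ _
  (cvg_norm (cvgB (cvg_retr cS Cu) (cvg_retr cS Cv)))).
near=> t.
have t0 : 0 < t by near: t; exact: nbhs_right_gt.
have t1 : t < 1 by near: t; exact: nbhs_right_lt.
rewrite -[leLHS]/(`|approx_fix C S u t - approx_fix C S v t|).
have [] := approx_fixP nS Cu t0 t1; have [] := approx_fixP nS Cv t0 t1.
move: (approx_fix C S u t) (approx_fix C S v t) => z y Cy yE Cz zE /=.
have zy : z - y = t *: (u - v) + (1 - t) *: (S z - S y).
  by rewrite {1}zE {1}yE !scalerBr opprD addrACA.
have := ler_normD (t *: (u - v)) ((1 - t) *: (S z - S y)).
rewrite -zy !normrZ gtr0_norm// gtr0_norm ?subr_gt0// => h.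
have := nonexpansiveP nS Cz Cy; move: h; move: `|z - y| `|S z - S y| `|u - v|.
move=> r1 r2 r3 h1 h2; have t1' : 0 <= 1 - t by lra.
rewrite -(ler_pM2l t0); have := ler_wpM2l t1' h2; lra.
Unshelve. all: by end_near. Qed.

(** The residual of the curve is [t] times the distance from [u] to [S z], which stays bounded. *)
Lemma retr_Fix S u : nonexpansive C S -> approx_fix_cvg C S -> C u ->
  Fix C S (retr C S u).
Proof.
move=> nS cS Cu; have Cq := retr_in nS cS Cu; split => //.
have := cvg_retr cS Cu; set q := retr C S u in Cq *; move=> zq.
apply/eqP; rewrite -subr_eq0 -normr_le0; apply/ler_addgt0Pl => e e0; rewrite addr0.
pose K := `|u - q| + `|q - S q|.
have K0 : 0 <= K by rewrite addr_ge0.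
(* The path from [q] over [z] and [S z] to [S q] has length at most
   [d + d * (K + 1) + d = d * (K + 3)]. *)
pose d := Num.min 1 (e / (K + 3)).
have d0 : 0 < d by rewrite lt_min ltr01 divr_gt0//; lra.
have [d1 dK] : d <= 1 /\ d * (K + 3) <= e.
  by rewrite -ler_pdivlMr ?ge_min ?lexx ?orbT//; lra.
have : \forall t \near 0^'+, [/\ 0 < t, t < d & `|q - approx_fix C S u t| < d].
  near=> t; split; near: t; [exact: nbhs_right_gt | exact: nbhs_right_lt |].
  by move/cvgrPdist_lt : zq; exact.
move=> /filter_ex[t [t0 td]].
have [] := approx_fixP nS Cu t0 (lt_le_trans td d1).
move: (approx_fix _ _ _ _) => z Cz zE qz.
have Sqz := nonexpansiveP nS Cq Cz.
have zSz : `|z - S z| = t * `|u - S z|.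
  rewrite -[t in RHS]gtr0_norm// -normrZ {1}zE; congr (`|_|).
  by rewrite scalerBr scalerBl scale1r -addrA addrAC subrr add0r.
have uSz : `|u - S z| <= K + d.
  have := ler_distD q u (S z); have := ler_distD (S q) q (S z).
  rewrite /K; lra.
have zSz' : `|z - S z| <= d * (K + d) by rewrite zSz ler_pM// ltW.
have Kd : d * (K + d) <= d * (K + 1) by rewrite ler_wpM2l ?lerD2l// ltW.
have := ler_distD z q (S q); have := ler_distD (S z) z (S q).
rewrite (distrC (S z)) (distrC _ q); lra.
Unshelve. all: by end_near. Qed.

(** A single [t] is fixed first, with [z] close to [q]; only then does [n] vary. Three errors of
    [e / 3] remain: moving [q] to [z] inside [J], moving [q] to [z] in [u - q], and the residual of
    [x n] in [approx_fix_VI]. A general filter allows ultrafilters as well as constant sequences. *)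
Lemma limsup_VI J S u (T : Type) (G : set_system T) (GG : ProperFilter G)
    (x : T -> X) (M : R) :
  norm_weakstar_duality J -> nonexpansive C S -> approx_fix_cvg C S -> C u ->
  (forall n, C (x n)) -> (forall n, `|x n| <= M) ->
  x n - S (x n) @[n --> G] --> (0 : X) ->
  forall e : R, 0 < e ->
    \forall n \near G, J (x n - retr C S u) (u - retr C S u) < e.
Proof.
move=> [JJ Jn Junif] nS cS Cu Cx xM xS e e0.
have zq := cvg_retr cS Cu; have Cq := retr_in nS cS Cu.
set q := retr C S u in zq Cq *.
pose N := `|M| + `|q| + 1.
have N0 : 0 < N by rewrite ltr_wpDl// addr_ge0.
have BN : bounded_set [set v : X | `|v| <= N].
  by exists N; split=> [|r Nr v /= vN]; [exact: num_real | exact: le_trans vN (ltW Nr)].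
have e3 : 0 < e / 3 by lra.
have [d d0 Jd] := Junif _ BN (u - q) (e / 3) e3.
have eN : 0 < e / 3 / N by rewrite divr_gt0.
(* The bound 1 keeps [x n - z] in the ball of radius [N], [d] is for uniform continuity, and the
   third bound makes [J (x n - z) (z - q)] small. *)
pose d' := Num.min 1 (Num.min d (e / 3 / N)).
have d'0 : 0 < d' by rewrite !lt_min ltr01 d0.
have : \forall t \near 0^'+, [/\ 0 < t, t < 1 & `|q - approx_fix C S u t| < d'].
  near=> t; split; near: t; [exact: nbhs_right_gt | exact: nbhs_right_lt |].
  by move/cvgrPdist_lt : zq; exact.
move=> /filter_ex[t [t0 t1]].
have := approx_fix_VI nS Cu _ t0 t1.
have [] := approx_fixP nS Cu t0 t1.
move: (approx_fix _ _ _ _) => z Cz _ VI; rewrite !lt_min => /and3P[qz1 qzd qze].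
have teN : 0 < t * (e / 3 / N) by rewrite mulr_gt0.
move/cvgr0Pnorm_lt : xS => /(_ _ teN); apply: filterS => n xSn.
have xN y : `|q - y| < 1 -> `|x n - y| <= N.
  move=> qy; have := ler_distD q (x n) y; have := ler_normB (x n) q.
  have := xM n; have := ler_norm M; rewrite /N; lra.
have xzN : `|x n - z| <= N by exact: xN.
have xqN : `|x n - q| <= N by apply: xN; rewrite subrr normr0.
have h1 : J (x n - q) (u - q) - J (x n - z) (u - q) < e / 3.
  apply: le_lt_trans (ler_norm _) _; apply: Jd => //.
  by rewrite opprB addrC subrKA distrC.
have h2 : J (x n - z) (z - q) < e / 3.
  apply: le_lt_trans (ler_norm _) _; apply: le_lt_trans (ler_dual_norm _ _) _.
  rewrite Jn (distrC z); move: qze; rewrite ltr_pdivlMr// => /le_lt_trans; apply.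
  by rewrite mulrC ler_wpM2l.
have h3 : J (x n - z) (u - z) < e / 3.
  apply: le_lt_trans (VI (x n) (J (x n - z)) (Cx n) (JJ _) (Jn _)) _.
  rewrite ltr_pdivrMl//; move: xSn; rewrite mulrA ltr_pdivlMr// => /le_lt_trans; apply.
  by rewrite ler_wpM2l.
have -> : J (x n - q) (u - q) = (J (x n - q) (u - q) - J (x n - z) (u - q)) +
    (J (x n - z) (z - q) + J (x n - z) (u - z)).
  have -> : J (x n - z) (u - q) = J (x n - z) (z - q) + J (x n - z) (u - z).
    by rewrite -dual_funD [z - q + _]addrC subrKA.
  by rewrite subrK.
lra.
Unshelve. all: by end_near. Qed.

Lemma retr_VI J S u p : norm_weakstar_duality J -> nonexpansive C S ->
  approx_fix_cvg C S -> C u -> Fix C S p ->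
  J (p - retr C S u) (u - retr C S u) <= 0.
Proof.
move=> nJ nS cS Cu [Cp Sp]; apply/ler_addgt0Pl => e e0; rewrite addr0.
have pS : (fun _ : nat => p - S p) n @[n --> \oo] --> (0 : X).
  by rewrite Sp subrr; exact: cvg_cst.
have := @limsup_VI J S u nat \oo eventually_filter (fun=> p) `|p| nJ nS cS Cu
  (fun=> Cp) (fun=> lexx _) pS e e0.
by move=> /filter_ex[_ /ltW].
Qed.

(** [norm_weakstar_duality] does not state that [J] is odd; passing to this reflected map lets two
    variational inequalities be tested by the same functional [J (q - q')]. *)
Lemma norm_weakstar_duality_opp J : norm_weakstar_duality J ->
  norm_weakstar_duality (fun x => - J (- x)).
Proof.
move=> [JJ Jn Junif]; have JE x y : (- J (- x)) y = - J (- x) y by [].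
split=> [x|x|B [M [Mr BM]] y e e0].
- by rewrite JE -dual_funN JJ normrN.
- by rewrite normrN Jn normrN.
have [|d d0 Jd] := Junif [set - v | v in B] _ y e e0.
  by exists M; split=> // r Mr' _ [v Bv <-]; rewrite /= normrN; exact: BM Bv.
exists d => // x x' Bx Bx' xx'; rewrite !JE -opprD normrN.
apply: Jd; [by exists x|by exists x'|].
by rewrite -opprD normrN.
Qed.

(** Each limit is a fixed point of both mappings, hence a test point for the inequality of the
    other; adding the two gives [J (q - q') (q - q') <= 0]. *)
Lemma retr_unique S S' u : B_space X -> nonexpansive C S -> nonexpansive C S' ->
  approx_fix_cvg C S -> approx_fix_cvg C S' -> Fix C S = Fix C S' -> C u ->
  retr C S u = retr C S' u.
Proof.
move=> /B_space_duality[J nJ] nS nS' cS cS' SS' Cu.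
have q_fix := retr_Fix nS cS Cu; have q'_fix := retr_Fix nS' cS' Cu.
rewrite SS' in q_fix; rewrite -SS' in q'_fix.
have := retr_VI nJ nS' cS' Cu q_fix.
have := retr_VI (norm_weakstar_duality_opp nJ) nS cS Cu q'_fix.
set q := retr C S u; set q' := retr C S' u.
rewrite opprB => h2 h1; have {}h2 : - J (q - q') (u - q) <= 0 := h2.
have h3 : J (q - q') (q - q') <= 0.
  have -> : J (q - q') (q - q') = J (q - q') (u - q') - J (q - q') (u - q).
    by rewrite -dual_funB (opprB u q) [u - q' + _]addrC subrKA.
  lra.
move: h3; have [-> _ _] := nJ; rewrite exprn_even_le0//= normr_eq0 subr_eq0.
by move/eqP.
Qed.

(** Banach's theorem for the retraction after [f] shows that the set chosen from by [xget] is
    nonempty. The mapping attached to the chosen point may differ from a given one, which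
    [retr_unique] repairs. *)
Lemma QFP F (f : X -> X) S alpha : B_space X -> C !=set0 -> nonexpansive C S ->
  approx_fix_cvg C S -> Fix C S = F -> contraction_on alpha C f ->
  let q := QF C F f in C q /\ forall S', nonexpansive C S' ->
    approx_fix_cvg C S' -> Fix C S' = F -> retr C S' (f q) = q.
Proof.
move=> XB C0 nS cS SF [al0 al1 Cf flip] q.
have flip' x y : C x -> C y -> `|f x - f y| <= alpha * `|x - y|.
  by move=> Cx Cy; exact: (flip (x, y) (conj Cx Cy)).
have [|||||x Cx xE] := @contraction_fixpoint (fun x => retr C S (f x)) alpha.
- exact: C0.
- exact: ltW.
- by [].
- by move=> x Cx; apply: retr_in => //; exact: Cf.
- move=> x y Cx Cy; apply: le_trans (flip' _ _ Cx Cy).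
  by apply: retr_nonexpansive => //; exact: Cf.
have [Cq [S0 [nS0 S0F cS0 qE]]] : [set x | C x /\ exists T, [/\ nonexpansive C T,
    Fix C T = F, approx_fix_cvg C T & x = retr C T (f x)]] q.
  by apply: xgetPex; exists x; split=> //; exists S.
split=> // S' nS' cS' S'F; rewrite [RHS]qE.
by apply: retr_unique => //; [rewrite S'F | exact: Cf].
Qed.

End FixedPointLemmas.

(** * Recursive inequalities with negligible perturbations *)

Section Negligible.
Context {R : realType}.
Implicit Types (al e : nat -> R).

(* [e] is, up to summable terms, negligible with respect to [al]: this covers
   both summable sequences and [o(al)], and finite sums of these. *)
Definition negligible al e := forall eps : R, 0 < eps ->
  exists N, exists d : nat -> R, [/\ forall n, 0 <= d n,
    forall n, (N <= n)%N -> e n <= eps * al n + d n &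
    forall m, \sum_(N <= k < m) d k <= eps].

Lemma ler_sum_nat_ge0 (d : nat -> R) N N' m : (forall n, 0 <= d n) -> (N <= N')%N ->
  \sum_(N' <= k < m) d k <= \sum_(N <= k < m) d k.
Proof.
move=> d0 NN'; have [mN'|N'm] := leqP m N'.
  by rewrite big_geq// sumr_ge0.
by rewrite [leRHS](@big_cat_nat _ _ _ N')//= ?(ltnW N'm)// lerDr sumr_ge0.
Qed.

Lemma negligible0 al : (forall n, 0 <= al n) -> negligible al (fun=> 0).
Proof.
move=> al0 eps eps0; exists 0%N, (fun=> 0); split=> // [n _|m].
  by rewrite addr0 mulr_ge0// ltW.
by rewrite big1// ltW.
Qed.

Lemma negligibleD al e e' : negligible al e -> negligible al e' ->
  negligible al (fun n => e n + e' n).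
Proof.
move=> ne ne' eps eps0; have e2 : 0 < eps / 2 by lra.
have [N [d [d0 ed dS]]] := ne _ e2; have [N' [d' [d'0 ed' dS']]] := ne' _ e2.
exists (maxn N N'), (fun n => d n + d' n); split=> [n|n|m].
- by rewrite addr_ge0.
- rewrite geq_max => /andP[Nn N'n]; have := ed n Nn; have := ed' n N'n; lra.
- rewrite big_split /=.
  have := @ler_sum_nat_ge0 d N _ m d0 (leq_maxl N N').
  have := @ler_sum_nat_ge0 d' N' _ m d'0 (leq_maxr N N').
  have := dS m; have := dS' m; lra.
Qed.

Lemma negligibleZ al e (K : R) : 0 < K -> negligible al e ->
  negligible al (fun n => K * e n).
Proof.
move=> K0 ne eps eps0; have [N [d [d0 ed dS]]] := ne _ (divr_gt0 eps0 K0).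
exists N, (fun n => K * d n); split=> [n|n Nn|m].
- by rewrite mulr_ge0// ltW.
- have := ed n Nn; rewrite -(ler_pM2l K0) mulrDr mulrA; congr (_ <= _ * _ + _).
  by rewrite mulrC divfK// gt_eqF.
- by rewrite -mulr_sumr -ler_pdivlMl// mulrC.
Qed.

Lemma negligible_sum (I : Type) (s : seq I) al (e : I -> nat -> R) :
  (forall n, 0 <= al n) -> (forall i, negligible al (e i)) ->
  negligible al (fun n => \sum_(i <- s) e i n).
Proof.
move=> al0 ne; elim: s => [|i s IHs].
  by under eq_fun do rewrite big_nil; exact: negligible0.
by under eq_fun do rewrite big_cons; exact: negligibleD.
Qed.

Lemma series_tail (d : nat -> R) N m : (N <= m)%N ->
  \sum_(N <= k < m) d k = [series d n]_n m - [series d n]_n N.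
Proof.
move=> Nm; rewrite /series /= (@big_cat_nat _ _ _ N 0 m)//=.
by rewrite addrAC subrr add0r.
Qed.

Lemma negligible_summable al e : (forall n, 0 <= al n) -> (forall n, 0 <= e n) ->
  cvgn [series e n]_n -> negligible al e.
Proof.
move=> al0 e0 ce eps eps0; have e2 : 0 < eps / 2 by lra.
move/cvgrPdist_lt : (ce) => /(_ _ e2) [N _ NP].
exists N, e; split=> // [n _|m].
  by rewrite lerDr mulr_ge0// ltW.
have [mN|Nm] := leqP m N; first by rewrite big_geq// ltW.
rewrite series_tail ?(ltnW Nm)//.
have := NP N (leqnn N); have := NP m (ltnW Nm); rewrite /= !ltr_distl; lra.
Qed.

Lemma negligible_o al e : (forall n, 0 < al n) ->
  e n / al n @[n --> \oo] --> (0 : R) -> negligible al e.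
Proof.
move=> al0 + eps eps0 => /cvgr0Pnorm_lt /(_ _ eps0) [N _ NP].
exists N, (fun=> 0); split=> // [n Nn|m]; last by rewrite big1// ltW.
rewrite addr0 -ler_pdivrMr//; apply: le_trans (ler_norm _) _.
exact/ltW/NP.
Qed.

(* The product of the [1 - c * al k] is at most [1 / (1 + c * \sum_k al k)]. *)
Lemma negligible_recursion_cvg0 al e (s : nat -> R) (c : R) : 0 < c ->
  (forall n, 0 <= al n) -> (forall n, c * al n <= 1) ->
  [series al n]_n @ \oo --> +oo -> (forall n, 0 <= s n) ->
  (forall n, s n.+1 <= (1 - c * al n) * s n + e n) -> negligible al e ->
  s n @[n --> \oo] --> (0 : R).
Proof.
move=> c0 al0 cal alS s0 srec ne; apply/cvgr0Pnorm_lt => eps eps0.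
(* Both [eta / c] and the sums of [d] are then at most [eps / 4]; the first term of [bound] gets
   there once [S m] is large. *)
pose eta := Num.min (eps / 4) (c * eps / 4).
have eta0 : 0 < eta by rewrite lt_min !divr_gt0// mulr_gt0.
have [N [d [d0 ed dS]]] := ne eta eta0.
pose S m : R := \sum_(N <= k < m) al k.
have S0 m : 0 <= S m by exact: sumr_ge0.
have bound m : (N <= m)%N ->
    s m <= s N / (1 + c * S m) + eta / c + \sum_(N <= k < m) d k.
  elim: m => [|m IHm]; rewrite leq_eqVlt => /predU1P[<-|//].
  - by rewrite /S !big_geq// mulr0 !addr0 divr1 lerDl divr_ge0// ltW.
  - by rewrite /S !big_geq// mulr0 !addr0 divr1 lerDl divr_ge0// ltW.
  rewrite ltnS => Nm.
  have SS : S m.+1 = S m + al m by rewrite /S big_nat_recr.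
  rewrite big_nat_recr//= SS.
  have D0 : 0 <= \sum_(N <= k < m) d k by exact: sumr_ge0.
  have x1 : 0 <= 1 - c * al m by rewrite subr_ge0.
  have h1 := ler_wpM2l x1 (IHm Nm).
  (* With [y = c * S m] and [z = c * al m] this is [(1 - z) * (1 + y + z) <= 1 + y]. *)
  have h2 : (1 - c * al m) * (s N / (1 + c * S m)) <= s N / (1 + c * (S m + al m)).
    rewrite mulrCA ler_wpM2l//.
    have p1 : 0 < 1 + c * S m by rewrite ltr_pwDl// mulr_ge0// ltW.
    have p2 : 0 < 1 + c * (S m + al m).
      by rewrite ltr_pwDl// mulr_ge0 ?(ltW c0)// addr_ge0.
    rewrite ler_pdivrMr// ler_pdivlMl//.
    have := mulr_ge0 (ltW c0) (S0 m); have := mulr_ge0 (ltW c0) (al0 m).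
    rewrite (mulrDr c); move: (c * S m) (c * al m) => y z z0 y0.
    by have := mulr_ge0 z0 y0; have := sqr_ge0 z; nra.
  have h3 : (1 - c * al m) * (eta / c) + eta * al m = eta / c.
    by field; rewrite gt_eqF.
  have h4 : (1 - c * al m) * \sum_(N <= k < m) d k <= \sum_(N <= k < m) d k.
    by rewrite ler_piMl// lerBlDr lerDl mulr_ge0// ltW.
  have := srec m; have := ed m Nm; lra.
move/cvgryPge : alS => /(_ ([series al n]_n N + 4 * s N / (c * eps))) Sge.
near=> m.
have Nm : (N <= m)%N by near: m; exact: nbhs_infty_ge.
have SL : 4 * s N / (c * eps) <= S m.
  by rewrite /S series_tail// lerBrDl; near: m.
rewrite ger0_norm//; apply: le_lt_trans (bound m Nm) _.
have h1 : s N / (1 + c * S m) <= eps / 4.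
  have p1 : 0 < 1 + c * S m by rewrite ltr_pwDl// mulr_ge0// ltW.
  rewrite ler_pdivrMr//.
  have := ler_wpM2l (ltW (mulr_gt0 c0 eps0)) SL.
  rewrite mulrC divfK ?gt_eqF ?mulr_gt0//; lra.
have h2 : eta / c <= eps / 4.
  by rewrite ler_pdivrMr// ge_min; apply/orP; right; lra.
have h3 : \sum_(N <= k < m) d k <= eps / 4.
  by apply: le_trans (dS m) _; rewrite ge_min lexx.
lra.
Unshelve. all: by end_near. Qed.

End Negligible.

(** * The viscosity iteration for a sequence of nonexpansive mappings *)

Lemma norm_squeeze0 (R : realType) (V : normedModType R) (T : Type)
    (G : set_system T) (GG : Filter G) (u : T -> R) (v : T -> V) :
  (forall t, `|v t| <= u t) -> u t @[t --> G] --> (0 : R) ->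
  v t @[t --> G] --> (0 : V).
Proof.
move=> vu /cvgr0Pnorm_lt u0; apply/cvgr0Pnorm_lt => e e0.
apply: filterS (u0 e e0) => t; apply: le_lt_trans.
exact: le_trans (vu t) (ler_norm _).
Qed.

Section ViscosityIteration.
Context {R : realType} {X : completeNormedModType R}.
Variables (C : set X) (alpha : R) (f : X -> X) (al : nat -> R).
Variables (S : nat -> X -> X) (x : nat -> X).
Hypotheses (C_convex : convex_set (C : set (convex_lmodType X)))
  (f_contraction : contraction_on alpha C f)
  (al_01 : forall n, 0 < al n /\ al n < 1)
  (S_nonexpansive : forall n, nonexpansive C (S n))
  (x0_C : C (x 0%N))
  (x_rec : forall n, x n.+1 = al n *: f (x n) + (1 - al n) *: S n (x n)).

Let al_gt0 n : 0 < al n. Proof. by have [] := al_01 n. Qed.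
Let al_lt1 n : al n < 1. Proof. by have [] := al_01 n. Qed.
Let al_ge0 n : 0 <= al n. Proof. exact: ltW. Qed.
Let onem_al_ge0 n : 0 <= 1 - al n. Proof. by rewrite subr_ge0 ltW. Qed.
Let c_gt0 : 0 < 1 - alpha.
Proof. by case: f_contraction => ? a1 _ _; rewrite subr_gt0. Qed.
Let alpha_ge0 : 0 <= alpha. Proof. by case: f_contraction => /ltW. Qed.

Let f_lip u v : C u -> C v -> `|f u - f v| <= alpha * `|u - v|.
Proof.
by move=> Cu Cv; have [_ _ _ fl] := f_contraction; exact: (fl (u, v) (conj Cu Cv)).
Qed.

Lemma viscosity_in n : C (x n).
Proof.
elim: n => [//|n IHn]; rewrite x_rec; apply: convex_comb2 => //.
  exact/ltW/al_lt1.
- by case: f_contraction => _ _ + _; exact.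
- by have [+ _] := S_nonexpansive n; exact.
Qed.
Let x_in := viscosity_in.

Lemma ler_norm_comb (t : R) (u v u' v' : X) : 0 <= t -> 0 <= 1 - t ->
  `|t *: u + (1 - t) *: v - (t *: u' + (1 - t) *: v')| <=
  t * `|u - u'| + (1 - t) * `|v - v'|.
Proof.
move=> t0 t1; rewrite opprD addrACA -!scalerBr.
by rewrite (le_trans (ler_normD _ _))// !normrZ !ger0_norm.
Qed.

Lemma viscosity_bounded p : C p -> (forall n, S n p = p) ->
  exists M, forall n, `|x n - p| <= M.
Proof.
(* On [C], the ball of this radius about [p] is preserved by every [S n] and also by [f], since
   [alpha * M + (1 - alpha) * M = M]. *)
move=> Cp Sp; exists (Num.max `|x 0%N - p| (`|f p - p| / (1 - alpha))).
set M := Num.max _ _.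
have Mf : `|f p - p| <= (1 - alpha) * M.
  by rewrite -ler_pdivrMl// mulrC le_max lexx orbT.
elim=> [|n IHn]; first by rewrite le_max lexx.
have pE : p = al n *: p + (1 - al n) *: p.
  by rewrite -scalerDl addrC subrK scale1r.
rewrite x_rec {1}pE (le_trans (ler_norm_comb _ _ _ _ _ _))//.
have h1 : `|S n (x n) - p| <= M.
  by apply: le_trans IHn; rewrite -{1}(Sp n); exact: (nonexpansiveP (S_nonexpansive n)).
have h2 : `|f (x n) - p| <= M.
  have := ler_distD (f p) (f (x n)) p; have := f_lip (x_in n) Cp.
  have := ler_wpM2l alpha_ge0 IHn; lra.
have := ler_wpM2l (al_ge0 n) h2; have := ler_wpM2l (onem_al_ge0 n) h1; lra.
Qed.

Lemma viscosity_gap_bounded p : C p -> (forall n, S n p = p) ->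
  exists K, forall n, `|f (x n) - S n (x n)| <= K.
Proof.
move=> Cp Sp; have [M xM] := viscosity_bounded Cp Sp.
exists (alpha * M + `|f p - p| + M) => n.
have := ler_distD (f p) (f (x n)) (S n (x n)).
have := ler_distD p (f p) (S n (x n)).
have := f_lip (x_in n) Cp; have := ler_wpM2l alpha_ge0 (xM n).
have := nonexpansiveP (S_nonexpansive n) Cp (x_in n); rewrite Sp (distrC p (x n)).
have := xM n; lra.
Qed.

Lemma viscosity_regular p (delta : nat -> R) : C p -> (forall n, S n p = p) ->
  [series al n]_n @ \oo --> +oo ->
  negligible al (fun n => `|al n.+1 - al n|) -> negligible al delta ->
  (forall n, `|S n.+1 (x n) - S n (x n)| <= delta n) ->
  `|x n.+1 - x n| @[n --> \oo] --> (0 : R).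
Proof.
move=> Cp Sp alS nal ndelta Sdelta.
have [M xM] := viscosity_bounded Cp Sp.
have [K' fS] := viscosity_gap_bounded Cp Sp.
have M0 : 0 <= M by exact: le_trans (xM 0%N).
have K'0 : 0 <= K' by exact: le_trans (fS 0%N).
(* [K'] pays for the change of weight between [B] and [x n.+1], the middle term for replacing
   [al n.+1] by [al n] in the contraction factor; adding 1 makes [K] positive. *)
pose K := K' + (1 - alpha) * (2 * M) + 1.
have K0 : 0 < K by have := mulr_ge0 (ltW c_gt0) M0; rewrite /K; lra.
apply: (@negligible_recursion_cvg0 _ al
  (fun n => K * `|al n.+1 - al n| + delta n) _ (1 - alpha)) => //.
- move=> n; have := al_lt1 n; have := al_gt0 n; have := alpha_ge0; nra.
- move=> n.
  (* From [x n.+2] to [x n.+1] one changes first the point (to [A]), then the mapping (to [B]), then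
     the weight. *)
  pose B := al n.+1 *: f (x n) + (1 - al n.+1) *: S n (x n).
  pose A := al n.+1 *: f (x n) + (1 - al n.+1) *: S n.+1 (x n).
  have h1 : `|x n.+2 - A| <= al n.+1 * (alpha * `|x n.+1 - x n|) +
      (1 - al n.+1) * `|x n.+1 - x n|.
    rewrite (x_rec n.+1) (le_trans (ler_norm_comb _ _ _ _ _ _))// lerD//.
      by rewrite ler_wpM2l// f_lip.
    by rewrite ler_wpM2l//; exact: (nonexpansiveP (S_nonexpansive n.+1)).
  have h2 : `|A - B| <= delta n.
    rewrite (le_trans (ler_norm_comb _ _ _ _ _ _))// subrr normr0 mulr0 add0r.
    by rewrite (le_trans _ (Sdelta n))// ler_piMl// gerBl.
  have h3 : `|B - x n.+1| <= `|al n.+1 - al n| * K'.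
    have -> : B - x n.+1 = (al n.+1 - al n) *: (f (x n) - S n (x n)).
      rewrite x_rec /B opprD addrACA -!scalerBl scalerBr -scaleNr.
      by congr (_ + _ *: _); ring.
    by rewrite normrZ ler_wpM2l.
  have s2M : `|x n.+1 - x n| <= 2 * M.
    have := ler_distD p (x n.+1) (x n); have := xM n; have := xM n.+1.
    rewrite (distrC p); lra.
  have h4 : - (al n.+1 - al n) * `|x n.+1 - x n| <= `|al n.+1 - al n| * (2 * M).
    have := ler_norm (- (al n.+1 - al n)); rewrite normrN => dn.
    apply: le_trans (ler_wpM2r (normr_ge0 _) dn) _.
    by rewrite ler_wpM2l.
  have h5 := ler_distD A (x n.+2) (x n.+1); have h6 := ler_distD B A (x n.+1).
  have := ler_wpM2l (ltW c_gt0) h4; have := normr_ge0 (al n.+1 - al n).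
  rewrite /K; lra.
- exact: negligibleD (negligibleZ _ _) ndelta.
Qed.

Lemma viscosity_residual p : C p -> (forall n, S n p = p) ->
  al n @[n --> \oo] --> (0 : R) -> `|x n.+1 - x n| @[n --> \oo] --> (0 : R) ->
  x n - S n (x n) @[n --> \oo] --> (0 : X).
Proof.
move=> Cp Sp alc reg; have [K fS] := viscosity_gap_bounded Cp Sp.
apply: (@norm_squeeze0 _ _ _ _ _ (fun n => `|x n.+1 - x n| + al n * K)).
  move=> n; have := ler_distD (x n.+1) (x n) (S n (x n)).
  rewrite (distrC (x n) (x n.+1)); have -> : x n.+1 - S n (x n) = al n *: (f (x n) - S n (x n)).
    by rewrite x_rec scalerBl scale1r scalerBr [S n _ - _]addrC addrA addrK.
  rewrite normrZ gtr0_norm//; have := ler_wpM2l (al_ge0 n) (fS n); lra.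
rewrite -[X in _ --> X]addr0 -[X in _ + X](mul0r K).
by apply: cvgD => //; apply: cvgMr_tmp.
Qed.

Lemma viscosity_cvg J q : norm_weakstar_duality J -> C q ->
  (forall n, S n q = q) -> [series al n]_n @ \oo --> +oo ->
  (forall e : R, 0 < e -> \forall n \near \oo, J (x n - q) (f q - q) < e) ->
  x n @[n --> \oo] --> q.
Proof.
move=> [JJ Jn _] Cq Sq alS limsup.
(* The functional is taken at the new iterate [x n.+1]; the positive part turns the limsup condition
   into a nonnegative sequence tending to 0. *)
pose beta n := Num.max 0 (J (x n.+1 - q) (f q - q)).
have beta0 n : 0 <= beta n by rewrite le_max lexx.
have : `|x n - q| ^+ 2 @[n --> \oo] --> (0 : R).
  apply: (@negligible_recursion_cvg0 _ al (fun n => 2 * al n * beta n) _ (1 - alpha)) => //.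
  - move=> n; have := al_lt1 n; have := al_gt0 n; have := alpha_ge0; nra.
  - move=> n.
    have qE : q = al n *: f q + (1 - al n) *: q - al n *: (f q - q).
      by rewrite scalerBr opprB [RHS]addrC subrKA -scalerDl addrC subrK scale1r.
    pose Y := al n *: f (x n) + (1 - al n) *: S n (x n) - (al n *: f q + (1 - al n) *: q).
    have xq : x n.+1 - q = Y + al n *: (f q - q).
      by rewrite {1}qE opprB x_rec addrA addrAC.
    have hY : `|Y| <= (1 - (1 - alpha) * al n) * `|x n - q|.
      rewrite (le_trans (ler_norm_comb _ _ _ _ _ _))//.
      have h1 := ler_wpM2l (al_ge0 n) (f_lip (x_in n) Cq).
      have h2 := nonexpansiveP (S_nonexpansive n) (x_in n) Cq; rewrite Sq in h2.
      have := ler_wpM2l (onem_al_ge0 n) h2; lra.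
    have hJ : `|x n.+1 - q| ^+ 2 <= `|x n.+1 - q| * `|Y| + al n * beta n.
      rewrite -{1}JJ {2}xq dual_funD dual_funZ lerD//.
        by rewrite (le_trans (ler_norm _))// (le_trans (ler_dual_norm _ _))// Jn.
      by rewrite ler_wpM2l// le_max lexx orbT.
    have theta0 : 0 <= 1 - (1 - alpha) * al n.
      have := al_lt1 n; have := al_gt0 n; have := alpha_ge0; nra.
    have theta1 : 1 - (1 - alpha) * al n <= 1.
      by rewrite gerBl mulr_ge0// ltW.
    have := ler_wpM2l (normr_ge0 (x n.+1 - q)) hY.
    (* From [P ^+ 2 <= theta * P * Q + ab] and [2 * P * Q <= P ^+ 2 + Q ^+ 2] with [theta <= 1]
       follows [P ^+ 2 <= theta * Q ^+ 2 + 2 * ab]. *)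
    move: (1 - (1 - alpha) * al n) theta0 theta1 hJ => theta theta0 theta1.
    move: `|x n.+1 - q| `|x n - q| `|Y| (al n * beta n) (mulrA 2 (al n) (beta n)).
    move=> P Q y ab <- hJ hPy.
    have := mulr_ge0 theta0 (sqr_ge0 (P - Q)).
    have := ler_piMl (sqr_ge0 P) theta1; nra.
  - move=> eps eps0; have [N _ NP] := limsup (eps / 2) ltac:(lra).
    exists N, (fun=> 0); split=> // [n Nn|m]; last by rewrite big1// ltW.
    have bn : beta n <= eps / 2.
      rewrite /beta ge_max divr_ge0 ?(ltW eps0)//=; apply/ltW/NP => /=; exact: leqW.
    have := ler_wpM2l (al_ge0 n) bn; lra.
move=> /cvgr0Pnorm_lt x2; apply/cvgrPdist_lt => e e0.
have e2 : 0 < e ^+ 2 by rewrite exprn_gt0.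
apply: filterS (x2 _ e2) => n; rewrite ger0_norm ?sqr_ge0// distrC.
by rewrite ltr_pXn2r ?nnegrE ?(ltW e0).
Qed.

End ViscosityIteration.

(** * Convergence for a finite family with varying weights *)

Theorem corollary12 (R : realType) (X : completeNormedModType R)
  (X_strictly_convex : strictly_convex X) (X_B : B_space X)
  (C : set X) (C_nonempty : C !=set0) (C_closed : closed C)
  (C_convex : convex_set (C : set (convex_lmodType X)))
  (I : finType) (T : I -> X -> X)
  (T_nonexpansive : forall i, nonexpansive C (T i))
  (F : set X) (F_def : F = \bigcap_i Fix C (T i)) (F_nonempty : F !=set0)
  (T_approx_fix_cvg : forall w : I -> R, (forall i, 0 < w i) ->
    \sum_(i : I) w i = 1 ->
    approx_fix_cvg C (fun x => \sum_(i : I) w i *: T i x))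
  (alpha : R) (f : X -> X) (f_contraction : contraction_on alpha C f)
  (al : nat -> R)
  (al_01 : forall n, 0 < al n /\ al n < 1)
  (al_cvg0 : al n @[n --> \oo] --> (0 : R))
  (al_series : [series al n]_n @ \oo --> +oo)
  (al_diff : cvgn [series `|al n.+1 - al n|]_n \/
    al n.+1 / al n @[n --> \oo] --> (1 : R))
  (lam : I -> nat -> R)
  (lam_sum : forall n, \sum_(i : I) lam i n = 1)
  (a b : R) (a_gt0 : 0 < a)
  (lam_ab : forall i n, a <= lam i n /\ lam i n <= b)
  (lam_diff : forall i, cvgn [series `|lam i n.+1 - lam i n|]_n \/
    `|lam i n.+1 - lam i n| / al n @[n --> \oo] --> (0 : R))
  (x : nat -> X) (x0_C : C (x 0%N))
  (x_rec : forall n, x n.+1 =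
    al n *: f (x n) + (1 - al n) *: \sum_(i : I) lam i n *: T i (x n)) :
  x n @[n --> \oo] --> QF C F f.
Proof.
have al0 n : 0 < al n by have [] := al_01 n.
have lam0 n i : 0 < lam i n by apply: lt_le_trans a_gt0 _; have [] := lam_ab i n.
pose S n y := \sum_(i : I) lam i n *: T i y.
have nS n : nonexpansive C (S n) by exact: nonexpansive_comb.
have bigcapF : \bigcap_i Fix C (T i) !=set0 by rewrite -F_def.
have FixF (w : I -> R) : (forall i, 0 < w i) -> \sum_i w i = 1 ->
    Fix C (fun y => \sum_i w i *: T i y) = F.
  by move=> w0 w1; rewrite F_def; exact: Fix_comb.
have [p Fp] := F_nonempty.
have SF n y : F y -> S n y = y.
  by rewrite -(FixF _ (lam0 n) (lam_sum n)) => -[].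
have Cp : C p by move: Fp; rewrite -(FixF _ (lam0 0%N) (lam_sum 0%N)) => -[].
have [Cq qP] := QFP C_closed C_convex X_B C_nonempty (nS 0%N)
  (T_approx_fix_cvg _ (lam0 0%N) (lam_sum 0%N)) (FixF _ (lam0 0%N) (lam_sum 0%N))
  f_contraction.
set q := QF C F f in Cq qP *.
have [_ _ Cf _] := f_contraction.
have Fq : F q.
  rewrite -(qP _ (nS 0%N) (T_approx_fix_cvg _ (lam0 0%N) (lam_sum 0%N))
    (FixF _ (lam0 0%N) (lam_sum 0%N))).
  rewrite -[F in F _](FixF _ (lam0 0%N) (lam_sum 0%N)).
  apply: retr_Fix => //; [exact: (nS 0%N) | exact: T_approx_fix_cvg | exact: Cf].
have xC := viscosity_in C_convex f_contraction al_01 nS x0_C x_rec.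
have [M xM] := viscosity_bounded C_convex f_contraction al_01 nS x0_C x_rec Cp (fun n => SF n p Fp).
have TxM i n : `|T i (x n)| <= M + `|p|.
  have Tp : T i p = p by move: Fp; rewrite F_def => /(_ i Logic.I)[].
  have := ler_normD (T i (x n) - p) p; rewrite subrK.
  have := nonexpansiveP (T_nonexpansive i) (xC n) Cp; rewrite Tp.
  have := xM n; lra.
have K0 : 0 <= M + `|p| by rewrite addr_ge0// (le_trans _ (xM 0%N)).
(* This serves twice: for consecutive weights in the regularity of the iteration, and for comparing
   [S n] with the limit mapping. *)
have Sdiff (w w' : I -> R) n : `|\sum_i w i *: T i (x n) - \sum_i w' i *: T i (x n)| <=
    (M + `|p| + 1) * \sum_i `|w i - w' i|.
  rewrite -sumrB mulr_sumr (le_trans (ler_norm_sum _ _ _))//.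
  apply: ler_sum => i _; rewrite -scalerBl normrZ mulrC ler_wpM2r//.
  by rewrite (le_trans (TxM i n))// lerDl.
have nal : negligible al (fun n => `|al n.+1 - al n|).
  case: al_diff => [ds|dr]; first exact: negligible_summable (fun n => ltW (al0 n)) _ ds.
  apply: negligible_o => //.
  have -> : (fun n => `|al n.+1 - al n| / al n) = (fun n => `|al n.+1 / al n - 1|).
    apply/funext => n; rewrite -[in RHS](divff (lt0r_neq0 (al0 n))) -mulrBl.
    by rewrite normrM normfV (gtr0_norm (al0 n)).
  by rewrite -(normr0 R) -(subrr 1); apply: cvg_norm; apply: cvgB => //; exact: cvg_cst.
have nlam : negligible al (fun n =>
    (M + `|p| + 1) * \sum_i `|lam i n.+1 - lam i n|).
  apply: negligibleZ; first by rewrite ltr_wpDl.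
  apply: negligible_sum => [n|i]; first exact: ltW.
  case: (lam_diff i) => [ds|dr]; last exact: negligible_o.
  exact: negligible_summable (fun n => ltW (al0 n)) _ ds.
have reg := viscosity_regular C_convex f_contraction al_01 nS x0_C x_rec Cp
  (fun n => SF n p Fp) al_series nal nlam (fun n => Sdiff _ _ n).
have xS := viscosity_residual C_convex f_contraction al_01 nS x0_C x_rec Cp
  (fun n => SF n p Fp) al_cvg0 reg.
have [J nJ] := B_space_duality X_B.
apply: (viscosity_cvg C_convex f_contraction al_01 nS x0_C x_rec nJ Cq
  (fun n => SF n q Fq) al_series) => e e0.
(* Along an ultrafilter the weights converge, and their limits stay positive because they are at
   least [a]. *)
apply: filter_ultra => G uG Goo.
have lamG i : exists l : R, lam i n @[n --> G] --> l.
  apply: (@ultra_bounded_cvg _ _ _ _ _ b) => n.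
  by rewrite gtr0_norm//; have [] := lam_ab i n.
have [w wP] := choice lamG.
have w0 i : 0 < w i.
  apply: lt_le_trans a_gt0 _.
  apply: (closed_cvg (fun s : R => a <= s) (@closed_ge _ _)) (wP i).
  by apply: (@filterE _ G) => n; have [] := lam_ab i n.
have w1 : \sum_i w i = 1.
  have lw : \sum_i lam i n @[n --> G] --> \sum_i w i.
    by apply: cvg_big => [|i _]; [exact: add_continuous | exact: wP].
  have l1 : \sum_i lam i n @[n --> G] --> (1 : R).
    by under eq_fun do rewrite lam_sum; exact: cvg_cst.
  exact: (cvg_unique (@norm_hausdorff _ _) lw l1).
have dw : \sum_i `|lam i n - w i| @[n --> G] --> (0 : R).
  have lamw i : `|lam i n - w i| @[n --> G] --> `|w i - w i|.
    by apply: cvg_norm; apply: cvgB; [exact: wP | exact: cvg_cst].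
  rewrite [Y in _ --> Y](_ : 0 = \sum_i `|w i - w i|); last first.
    by rewrite big1// => i _; rewrite subrr normr0.
  by apply: cvg_big => [|i _]; [exact: add_continuous | exact: lamw].
have nSw := nonexpansive_comb C_convex T_nonexpansive w0 w1.
have cSw := T_approx_fix_cvg w w0 w1.
have xSw : x n - (\sum_i w i *: T i (x n)) @[n --> G] --> (0 : X).
  apply: (@norm_squeeze0 _ _ _ _ _ (fun n => `|x n - S n (x n)| +
      (M + `|p| + 1) * \sum_i `|lam i n - w i|)) => [n|].
    by rewrite (le_trans (ler_distD (S n (x n)) _ _))// lerD2l Sdiff.
  rewrite [Y in _ --> Y](_ : 0 = `|0 : X| + (M + `|p| + 1) * 0); last first.
    by rewrite normr0 mulr0 addr0.
  apply: cvgD; last exact: cvgMl_tmp.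
  by apply: cvg_norm => A /xS; exact: Goo.
(* The limit mapping depends on [G], but by [qP] its retraction sends [f q] to the same [q]. *)
have := @limsup_VI _ _ C C_closed C_convex J _ (f q) nat G _ x (M + `|p|)
  nJ nSw cSw (Cf q Cq) xC _ xSw e e0.
rewrite (qP _ nSw cSw (FixF w w0 w1)); apply => n.
have := ler_normD (x n - p) p; rewrite subrK; have := xM n; lra.
Qed.
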